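(* Let $X=X(\mathbb{R}^d,\mu;q)$, $0<q\le1$, be a quasi-Banach lattice. Assume that there exist constants $B_\alpha>0$, $\alpha\in\mathbb{Z}_+^d$, and $A>0$ such that for all $\alpha\in\mathbb{Z}_+^d$ $$\|D^\alpha g_\sigma\|_X\le B_\alpha\sigma^{|\alpha|_1}\|g_\sigma\|_X,\qquad g_\sigma\in\mathcal{B}_X^\sigma,$$ and $\sum_{\alpha\in\mathbb{Z}_+^d,\ \alpha\ne0}\left(\frac{A^{|\alpha|_1}B_\alpha}{\alpha!}\right)^q<1$. Then, for all $g_\sigma\in\mathcal{B}_X^\sigma$ and $W\ge\frac\sigma A$, $$\|g_\sigma\|_X\asymp\bigg\|\sum_{k\in\mathbb{Z}^d}|g_\sigma(x_k)|\chi_{\Omega_k}\bigg\|_X,$$ where $x_k$ is an arbitrary point in $\Omega_k=\left[\frac{k_1-1}W,\frac{k_1}W\right]\times\dots\times\left[\frac{k_d-1}W,\frac{k_d}W\right]$, $k\in\mathbb{Z}^d$.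
   Context: $\mu$ is a positive $\sigma$-finite measure on $\mathbb{R}^d$. A quasi-Banach (function) lattice $X=X(\mathbb{R}^d,\mu;q)$, $0<q\le1$, is a complete space of functions on $\mathbb{R}^d$ with a functional $\|\cdot\|_X$ such that: 1) $\|f\|_X=0$ iff $f=0$; 2) $\|\lambda f\|_X=|\lambda|\|f\|_X$ for $\lambda\in\mathbb{C}$; 3) $\|f+g\|_X^q\le\|f\|_X^q+\|g\|_X^q$; 4) if $|f|\le|g|$ then $\|f\|_X\le\|g\|_X$ for $f,g\in X$; 5) $\chi_B\in X$ for all $B$ with $\mu(B)<\infty$. For $\sigma>0$, the class of band-limited functions is $\mathcal{B}_X^\sigma=\{\varphi\in X\cap L_1(\mathbb{R}^d):\operatorname{supp}\widehat\varphi\subset Q(0,\sigma)\}$, where $Q(0,\sigma)=\{y\in\mathbb{R}^d:\|y\|_\infty\le\sigma\}$ and $\widehat g(x)=\int_{\mathbb{R}^d}g(y)e^{-i(x,y)}dy$. $|\alpha|_1=\alpha_1+\dots+\alpha_d$, $\alpha!=\alpha_1!\cdots\alpha_d!$, $D^\alpha=\partial^{|\alpha|_1}/\partial x_1^{\alpha_1}\cdots\partial x_d^{\alpha_d}$. $A\asymp B$ means two-sided inequalities with positive constants independent of the essential variables (here $\sigma$, $W$, $g_\sigma$, and the points $x_k$). *)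

(* Defs.v *)
From HB Require Import structures.
From mathcomp Require Import all_boot all_order all_algebra.
From mathcomp Require Import complex.
From mathcomp Require Import all_classical all_reals all_analysis.

Set Implicit Arguments.
Unset Strict Implicit.
Unset Printing Implicit Defensive.

Import Order.TTheory GRing.Theory Num.Theory.
Import numFieldNormedType.Exports.
Import Normc.

Local Open Scope classical_set_scope.
Local Open Scope ring_scope.
Local Open Scope complex_scope.

(* 'rV[R]_d carries the product of the Borel sigma-algebras of R, i.e. the
   Borel sigma-algebra of R^d. *)
Definition rV_display : measure_display. Proof. exact. Qed.

Section measurable_rV.
Context {R : realType} (d : nat).

Let coord (i : 'I_d) (v : 'rV[R]_d) : measurableTypeR R := v 0 i.

Let rV_set0 : g_sigma_preimage coord set0.
Proof. exact: sigma_algebra0. Qed.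

Let rV_setC A : g_sigma_preimage coord A -> g_sigma_preimage coord (~` A).
Proof. exact: sigma_algebraC. Qed.

Let rV_bigcup (F : _^nat) : (forall i, g_sigma_preimage coord (F i)) ->
  g_sigma_preimage coord (\bigcup_i (F i)).
Proof. exact: sigma_algebra_bigcup. Qed.

HB.instance Definition _ := @isMeasurable.Build rV_display
  'rV[R]_d (g_sigma_preimage coord) rV_set0 rV_setC rV_bigcup.

End measurable_rV.

Lemma measurable_coord {R : realType} d (i : 'I_d) :
  measurable_fun [set: 'rV[R]_d]
    (fun v : 'rV[R]_d => v 0 i : measurableTypeR R).
Proof.
move=> _ Y mY; rewrite setTI; apply: sub_sigma_algebra => /=.
rewrite -bigcup_seq/=; exists i => /=; first by rewrite mem_index_enum.
by exists Y => //; rewrite setTI.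
Qed.

Lemma measurable_fun_rV {R : realType} d0 (T : measurableType d0) d
    (f : T -> 'rV[R]_d) :
  (forall i, measurable_fun setT (fun t => f t 0 i : measurableTypeR R)) ->
  measurable_fun setT f.
Proof.
move=> mf; apply: (@measurability _ _ _ _ _ _
  (\big[setU/set0]_(i < d) preimage_set_system setT
     (fun v : 'rV[R]_d => v 0 i : measurableTypeR R) measurable)) => //.
move=> _ [B + <-]; rewrite -bigcup_seq/= => -[i _ [Y mY <-]].
by rewrite !setTI; have := mf i measurableT Y mY; rewrite setTI.
Qed.

Section lebesgue_rV_step.
Context {R : realType} (d : nat).

Definition rV_cons (p : measurableTypeR R * 'rV[R]_d) : 'rV[R]_d.+1 :=
  \row_i (if unlift ord0 i is Some j then p.2 0 j else p.1).

Let rV_uncons (v : 'rV[R]_d.+1) : measurableTypeR R * 'rV[R]_d :=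
  (v 0 ord0, \row_j v 0 (lift ord0 j)).

Let rV_consK : cancel rV_cons rV_uncons.
Proof.
move=> [x v]; rewrite /rV_uncons /rV_cons mxE unlift_none; congr pair.
by apply/rowP => j; rewrite !mxE liftK.
Qed.

Let rV_unconsK : cancel rV_uncons rV_cons.
Proof.
move=> v; apply/rowP => i; rewrite mxE /=.
by case: unliftP => [j ->|->] //; rewrite mxE.
Qed.

Lemma measurable_rV_cons : measurable_fun setT rV_cons.
Proof.
apply: measurable_fun_rV => i.
rewrite (_ : (fun t => _) = (fun p : measurableTypeR R * 'rV[R]_d =>
    if unlift ord0 i is Some j then p.2 0 j else p.1)); last first.
  by apply/funext => p; rewrite mxE.
case: (unlift ord0 i) => [j|]; last exact: measurable_fst.
apply: (measurableT_comp (measurable_coord j)); exact: measurable_snd.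
Qed.

Let measurable_rV_uncons : measurable_fun setT rV_uncons.
Proof.
apply/measurable_fun_pairP; split; first exact: measurable_coord.
apply: measurable_fun_rV => j.
rewrite (_ : (fun t => _) = (fun v : 'rV[R]_d.+1 =>
    v 0 (lift ord0 j) : measurableTypeR R)); first exact: measurable_coord.
by apply/funext => v; rewrite /= mxE.
Qed.

Variable m : {sigma_finite_measure set 'rV[R]_d -> \bar R}.

Definition lebesgue_rV_step : set 'rV[R]_d.+1 -> \bar R :=
  pushforward (@lebesgue_measure R \x m)%E rV_cons.

Let step0 : lebesgue_rV_step set0 = 0%E.
Proof. by rewrite /lebesgue_rV_step /pushforward preimage_set0 measure0. Qed.

Let step_ge0 A : (0 <= lebesgue_rV_step A)%E.
Proof. by rewrite /lebesgue_rV_step /pushforward; exact: measure_ge0. Qed.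

Let step_sigma_additive : semi_sigma_additive lebesgue_rV_step.
Proof.
move=> F mF tF mUF; rewrite /lebesgue_rV_step /pushforward preimage_bigcup.
apply: measure_semi_sigma_additive.
- by move=> n; rewrite -[X in measurable X]setTI; exact: measurable_rV_cons.
- apply/trivIsetP => /= i j _ _ ij; rewrite -preimage_setI.
  by move/trivIsetP : tF => /(_ _ _ _ _ ij) ->//; rewrite preimage_set0.
- by rewrite -preimage_bigcup -[X in measurable X]setTI;
    exact: measurable_rV_cons.
Qed.

HB.instance Definition _ := isMeasure.Build _ _ _
  lebesgue_rV_step step0 step_ge0 step_sigma_additive.

Let step_sigma_finite : sigma_finite setT lebesgue_rV_step.
Proof.
have /sigma_finiteP[F [TF ndF Foo]] := sigma_finiteT (@lebesgue_measure R).
have /sigma_finiteP[G [TG ndG Goo]] := sigma_finiteT m.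
exists (fun n => rV_uncons @^-1` (F n `*` G n)).
  rewrite -preimage_bigcup; apply/esym/seteqP; split => // v _ /=.
  have : [set: measurableTypeR R] (rV_uncons v).1 by [].
  have : [set: 'rV[R]_d] (rV_uncons v).2 by [].
  rewrite {1}TF {1}TG => -[k _ Gk] [n _ Fn].
  exists (maxn n k) => //; split.
    exact: (subsetPset _ _ (ndF _ _ (leq_maxl n k))).
  exact: (subsetPset _ _ (ndG _ _ (leq_maxr n k))).
move=> n; have [mF Fn] := Foo n; have [mG Gn] := Goo n; split.
  rewrite -[X in measurable X]setTI.
  by apply: measurable_rV_uncons => //; exact: measurableX.
rewrite /lebesgue_rV_step /pushforward -comp_preimage.
rewrite (_ : rV_uncons \o rV_cons = id); last exact/funext.
rewrite preimage_id product_measure1E//.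
by rewrite lte_mul_pinfty// ge0_fin_numE.
Qed.

HB.instance Definition _ := Measure_isSigmaFinite.Build _ _ _
  lebesgue_rV_step step_sigma_finite.

End lebesgue_rV_step.

(* Lebesgue measure on R^d, as an iterated product measure. *)
Fixpoint lebesgue_rV (R : realType) (d : nat) :
    {sigma_finite_measure set 'rV[R]_d -> \bar R} :=
  match d with
  | 0 => \d_(0 : 'rV[R]_0)
  | n.+1 => lebesgue_rV_step (lebesgue_rV R n)
  end.

Lemma lebesgue_rV_box (R : realType) (d : nat)
    (A : 'I_d -> set (measurableTypeR R)) :
  (forall i, measurable (A i)) ->
  lebesgue_rV R d [set v : 'rV[R]_d | forall i, A i (v 0 i)] =
  (\prod_(i < d) lebesgue_measure (A i))%E.
Proof.
elim: d A => [|d IH] A mA.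
  rewrite big_ord0 /= diracE mem_set// => -[].
  by move=> [].
rewrite big_ord_recl /= /lebesgue_rV_step /pushforward.
rewrite (_ : _ @^-1` _ = A ord0 `*`
    [set v : 'rV[R]_d | forall i, A (lift ord0 i) (v 0 i)]).
  rewrite product_measure1E//; first by rewrite (IH (fun i => A (lift ord0 i))).
  rewrite (_ : [set _ | _] = \bigcap_(i in [set: 'I_d])
      ((fun v : 'rV[R]_d => v 0 i : measurableTypeR R) @^-1` A (lift ord0 i))).
    apply: fin_bigcap_measurable => // i _; rewrite -[X in measurable X]setTI.
    exact: measurable_coord.
  by apply/seteqP; split => v /= h i; [move=> _; exact: h|exact: h].
apply/seteqP; split => [[x v] /= h|[x v] /= [hx hv] i].
  split=> [|i]; first by have := h ord0; rewrite mxE unlift_none.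
  by have := h (lift ord0 i); rewrite mxE liftK.
by rewrite mxE; case: unliftP => [j ->|->].
Qed.

Section band_limited.
Context {R : realType} (d : nat).
Local Notation Rd := 'rV[R]_d.
Local Notation C := R[i].
Local Notation cRe := (@complex.Re R).
Local Notation cIm := (@complex.Im R).
Implicit Types (f g : Rd -> C) (x y : Rd).

Definition cmeasurable f :=
  measurable_fun setT (cRe \o f) /\ measurable_fun setT (cIm \o f).

Definition L1 f :=
  (lebesgue_rV R d).-integrable setT (EFin \o (cRe \o f)) /\
  (lebesgue_rV R d).-integrable setT (EFin \o (cIm \o f)).

Definition cintegral f : C :=
  (\int[lebesgue_rV R d]_y cRe (f y)) +i*
  (\int[lebesgue_rV R d]_y cIm (f y)).

Definition dotrV x y : R := \sum_(i < d) x 0 i * y 0 i.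

Definition expNi (t : R) : C := cos t -i* sin t.

Definition fourier f x : C := cintegral (fun y => f y * expNi (dotrV x y)).

Definition cube (sigma : R) : set Rd := [set y | forall i, `|y 0 i| <= sigma].

(* The elements of [X] are classes of functions, but point values and partial
   derivatives of a band-limited function are those of its continuous
   representative, hence the continuity requirement. *)
Definition band_limited (X : set (Rd -> C)) (sigma : R) : set (Rd -> C) :=
  [set f | [/\ X f, L1 f, continuous (cRe \o f) /\ continuous (cIm \o f) &
    closure [set x | fourier f x != 0] `<=` cube sigma]].

Definition multi_index := {ffun 'I_d -> nat}.

Definition mi_abs (a : multi_index) : nat := (\sum_(i < d) a i)%N.
Definition mi_fact (a : multi_index) : nat := (\prod_(i < d) (a i)`!)%N.

(* [R[i]] is not a normed module over [R]: derivatives are taken on real and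
   imaginary parts. *)
Definition partial (i : 'I_d) f : Rd -> C := fun x =>
  ('D_(delta_mx 0 i) (cRe \o f) x) +i* ('D_(delta_mx 0 i) (cIm \o f) x).

Definition partials (a : multi_index) f : Rd -> C :=
  foldr (fun i h => iter (a i) (partial i) h) f (enum 'I_d).

Definition lattice_cell (W : R) (k : {ffun 'I_d -> int}) : set Rd :=
  [set y | forall i, ((k i)%:~R - 1) / W <= y 0 i <= (k i)%:~R / W].

(* For [W > 0] every point lies in finitely many (at most [2 ^ d]) cells, so
   that the sum over Z^d is pointwise finite. *)
Definition sampled (W : R) (xi : {ffun 'I_d -> int} -> Rd) f : Rd -> C :=
  fun y => (\sum_(k \in [set: {ffun 'I_d -> int}])
     normc (f (xi k)) * \1_(lattice_cell W k) y)%:C.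

End band_limited.

(* A space [X] of (classes modulo equality mu-a.e. of) measurable complex
   functions, with its functional [N], which is only relevant on [X]. *)
Record quasi_banach_lattice (R : realType) (d : nat)
    (mu : {measure set 'rV[R]_d -> \bar R}) (q : R)
    (X : set ('rV[R]_d -> R[i])) (N : ('rV[R]_d -> R[i]) -> R) : Prop := {
  qbl_measurable : forall f, X f -> cmeasurable f ;
  qbl_ae : forall f g, X f -> cmeasurable g ->
    {ae mu, forall x, f x = g x} -> X g ;
  qbl_add : forall f g, X f -> X g -> X (f \+ g) ;
  qbl_scale : forall (l : R[i]) f, X f -> X (fun x => l * f x) ;
  qbl_abs : forall f, X f -> X (fun x => (normc (f x))%:C) ;
  qbl_complete : forall u : nat -> 'rV[R]_d -> R[i],
    (forall n, X (u n)) ->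
    (forall e, 0 < e -> exists n0, forall m n, (n0 <= m)%N -> (n0 <= n)%N ->
       N (u m \- u n) < e) ->
    exists2 f, X f & (fun n => N (u n \- f)) @ \oo --> (0 : R) ;
  qbl_ge0 : forall f, X f -> 0 <= N f ;
  qbl_eq0 : forall f, X f -> (N f = 0 <-> {ae mu, forall x, f x = 0}) ;
  qbl_normZ : forall (l : R[i]) f, X f ->
    N (fun x => l * f x) = normc l * N f ;
  qbl_triangle : forall f g, X f -> X g ->
    N (f \+ g) `^ q <= N f `^ q + N g `^ q ;
  qbl_le : forall f g, X f -> X g ->
    {ae mu, forall x, normc (f x) <= normc (g x)} -> N f <= N g ;
  qbl_indic : forall B : set 'rV[R]_d, measurable B -> (mu B < +oo)%E ->
    X (fun x => (\1_B x)%:C)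
}.

(* The ideal property; it is not implied by [qbl_le], which only compares
   elements of [X]. *)
Definition solid (R : realType) (d : nat)
    (mu : {measure set 'rV[R]_d -> \bar R}) (X : set ('rV[R]_d -> R[i])) :=
  forall f g, cmeasurable f -> X g ->
    {ae mu, forall x, normc (f x) <= normc (g x)} -> X f.

(* Main.v *)
Require Import Defs.
From HB Require Import structures.
From mathcomp Require Import all_boot all_order all_algebra.
From mathcomp Require Import complex.
From mathcomp Require Import all_classical all_reals all_analysis.
From mathcomp Require Import measurable_realfun ring lra.

(* A band-limited g is a Fourier integral over the cube, so it equals the sum of
   its Taylor series everywhere; hence |g(x) - g(y)| is at most
   \sum_(a <> 0) |D^a g(y)| W^-|a| / a! when x and y lie in a common cell.  By the
   Bernstein-type hypothesis and completeness of X, this series is dominated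
   mu-a.e. by some f in X with N(f)^q <= theta N(g)^q, where theta < 1 is the sum
   of the (A^|a| B_a / a!)^q.  As every point lies in at least one and at most 2^d
   cells, |g| <= S + f and S <= 2^d (|g| + f) for the sampled function S, and the
   q-triangle inequality gives both bounds.

   Fourier inversion comes from pairing g with products of tent functions, whose
   Fourier transforms are Fejer kernels: the pairing is an integral of the
   transform of g against these kernels, and the tents concentrate at a point. *)

Set Implicit Arguments.
Unset Strict Implicit.
Unset Printing Implicit Defensive.

Import Order.TTheory GRing.Theory Num.Theory.
Import numFieldNormedType.Exports.
Import Normc.

Local Open Scope classical_set_scope.
Local Open Scope ring_scope.
Local Open Scope complex_scope.

(** * Taylor bounds for sine and cosine *)

(** The Taylor series is centred at the point where norms are taken, not at the sample point: only
    derivatives at that point enter, and one majorant [f], off one null set, controls the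
    oscillation towards all nearby points at once, whatever the [x_k]. The lattice offers only norm
    completeness, so the norm limit of the partial sums is not known to be their pointwise limit;
    domination is instead read off from the order. For a continuous integrable [g], inversion is
    obtained from an exact identity at each scale. The integral of [(1 - cos (s x)) / x ^ 2] is
    proportional to [|s|], and a tent is a second difference of the absolute value, so a tent is a
    cosine integral of a Fejer kernel. The two sides of the pairing then converge separately, one by
    continuity of [g], the other by dominated convergence on the cube. On the cube the frequencies
    are bounded, so differentiation under the integral and the convergence of the Taylor series both
    follow from uniform bounds on the exponential. Complex functions are handled through pairs of
    real integrals. *)

Section trig_taylor.
Context {R : realType}.
Implicit Types (t : R) (N : nat).

(** Real part of the partial sum of [exp (i t)]. With coefficients taken from powers of [i],
    differentiation is an index shift, with no case split on parity. *)
Definition cos_taylor N t : R :=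
  \sum_(a < N) complex.Re ('i%C ^+ a : R[i]) * (t ^+ a / a`!%:R).
Definition sin_taylor N t : R :=
  \sum_(a < N) complex.Im ('i%C ^+ a : R[i]) * (t ^+ a / a`!%:R).

Lemma Re_ipow_succ a :
  complex.Re ('i%C ^+ a.+1 : R[i]) = - complex.Im ('i%C ^+ a : R[i]).
Proof.
by rewrite exprS; case: ('i%C ^+ a) => x y /=; rewrite mul0r mul1r sub0r.
Qed.

Lemma Im_ipow_succ a :
  complex.Im ('i%C ^+ a.+1 : R[i]) = complex.Re ('i%C ^+ a : R[i]).
Proof.
by rewrite exprS; case: ('i%C ^+ a) => x y /=; rewrite mul0r mul1r add0r.
Qed.

Lemma is_derive_taylor_monomial (c : R) a t :
  is_derive t 1 (fun s => c * (s ^+ a.+1 / a.+1`!%:R)) (c * (t ^+ a / a`!%:R)).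
Proof.
rewrite (_ : (fun s => _) = (c / a.+1`!%:R) \*: (@id R ^+ a.+1)); last first.
  by apply/funext => s /=; rewrite /GRing.scale/= exprfctE mulrA mulrAC.
apply: is_derive_eq.
have h1 : (a`!%:R : R) != 0 by rewrite pnatr_eq0 -lt0n fact_gt0.
have h2 : (1 + a%:R : R) != 0 by rewrite nat1r pnatr_eq0.
rewrite /GRing.scale/= mulr1 factS natrM.
by field; rewrite h1 h2.
Qed.

(** For [t >= 0] the difference of [t ^ (N+1) / (N+1)!] and [g] vanishes at 0 and has nonnegative
    derivative, so the mean value theorem bounds [g] above. Applying this to [- g] and to [g (- t)]
    gives the absolute values and the negative half-line. *)
Lemma taylor_bound_succ (g dg : R -> R) N :
  (forall t, is_derive t 1 g (dg t)) -> g 0 = 0 ->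
  (forall t, `|dg t| <= `|t| ^+ N / N`!%:R) ->
  forall t, `|g t| <= `|t| ^+ N.+1 / N.+1`!%:R.
Proof.
have half (f df : R -> R) : (forall t, is_derive t 1 f (df t)) -> f 0 = 0 ->
    (forall t, 0 <= t -> df t <= t ^+ N / N`!%:R) ->
    forall t, 0 <= t -> f t <= t ^+ N.+1 / N.+1`!%:R.
  move=> fdf f0 dfN t t0.
  pose h (s : R) : R := 1 * (s ^+ N.+1 / N.+1`!%:R) - f s.
  have hD (s : R) : is_derive s 1 h (1 * (s ^+ N / N`!%:R) - df s).
    by apply: is_deriveB; exact: is_derive_taylor_monomial.
  have [|s] := @MVT_segment R h _ 0 t t0 (fun s _ => hD s).
    apply: continuous_subspaceT => s; apply: differentiable_continuous.
    exact/derivable1_diffP/ex_derive.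
  rewrite in_itv/= => /andP[s0 _].
  rewrite /h f0 expr0n mul0r !mul1r !subr0 => /eqP; rewrite subr_eq => /eqP ->.
  by rewrite lerDr mulr_ge0// subr_ge0; exact: dfN.
move=> gdg g0 dgN.
have two (f df : R -> R) : (forall t, is_derive t 1 f (df t)) -> f 0 = 0 ->
    (forall t, `|df t| <= `|t| ^+ N / N`!%:R) ->
    forall t, 0 <= t -> `|f t| <= t ^+ N.+1 / N.+1`!%:R.
  move=> fdf f0 dfN t t0; rewrite ler_norml lerNl; apply/andP; split.
    apply: (half (\- f) (\- df)) => //=; first by rewrite f0 oppr0.
    by move=> s s0; have := dfN s; rewrite ler_norml ger0_norm// lerNl => /andP[].
  apply: (half f df) => //=.
  by move=> s s0; have := dfN s; rewrite ler_norml ger0_norm// => /andP[].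
move=> t; have [t0|/ltW t0] := leP 0 t; first by rewrite (ger0_norm t0) (two g dg).
rewrite (ler0_norm t0) -[t in leLHS]opprK.
apply: (two (fun s => g (- s)) (fun s => dg (- s) * -1)).
- by rewrite /= oppr0 g0.
- by move=> s; rewrite mulrN1 normrN (le_trans (dgN _))// normrN.
- by rewrite oppr_ge0.
Qed.

Lemma is_derive_cos_taylor N t :
  is_derive t 1 (cos_taylor N.+1) (- sin_taylor N t).
Proof.
elim: N => [|N IH].
  rewrite (_ : cos_taylor 1 = cst 1); last first.
    by apply/funext => s; rewrite /cos_taylor big_ord1 expr0 fact0 divr1 mul1r.
  by rewrite /sin_taylor big_ord0 oppr0; exact: is_derive_cst.
rewrite (_ : cos_taylor N.+2 = cos_taylor N.+1 \+
    (fun s => complex.Re ('i%C ^+ N.+1 : R[i]) * (s ^+ N.+1 / N.+1`!%:R))).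
  rewrite /sin_taylor big_ord_recr/= opprD -mulNr -Re_ipow_succ.
  by apply: is_deriveD; exact: is_derive_taylor_monomial.
by apply/funext => s; rewrite /cos_taylor big_ord_recr.
Qed.

Lemma is_derive_sin_taylor N t :
  is_derive t 1 (sin_taylor N.+1) (cos_taylor N t).
Proof.
elim: N => [|N IH].
  rewrite (_ : sin_taylor 1 = cst 0); last first.
    by apply/funext => s; rewrite /sin_taylor big_ord1 expr0 mul0r.
  by rewrite /cos_taylor big_ord0; exact: is_derive_cst.
rewrite (_ : sin_taylor N.+2 = sin_taylor N.+1 \+
    (fun s => complex.Im ('i%C ^+ N.+1 : R[i]) * (s ^+ N.+1 / N.+1`!%:R))).
  rewrite /cos_taylor big_ord_recr/= -Im_ipow_succ.
  by apply: is_deriveD; exact: is_derive_taylor_monomial.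
by apply/funext => s; rewrite /sin_taylor big_ord_recr.
Qed.

(** The two bounds are proved together because the remainders of sine and cosine are, up to sign,
    derivatives of one another. *)
Lemma trig_taylor_bound N t :
  `|cos t - cos_taylor N t| <= `|t| ^+ N / N`!%:R /\
  `|sin t - sin_taylor N t| <= `|t| ^+ N / N`!%:R.
Proof.
elim: N t => [t|N IH t].
  rewrite /cos_taylor /sin_taylor !big_ord0 !subr0 expr0 fact0 divr1.
  by rewrite !ler_norml cos_geN1 cos_le1 sin_geN1 sin_le1.
have T0 (P : R[i] -> R) :
    \sum_(a < N.+1) P ('i%C ^+ a) * ((0 : R) ^+ a / a`!%:R) = P 1.
  rewrite big_ord_recl expr0 fact0 divr1 mulr1 big1 ?addr0// => i _.
  by rewrite expr0n/= mul0r mulr0.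
split.
  apply: (@taylor_bound_succ (cos \- cos_taylor N.+1)
      (fun s => - (sin s - sin_taylor N s))).
  - by move=> s; rewrite opprD; apply: is_deriveB;
      exact: is_derive_cos_taylor.
  - by rewrite /= cos0 /cos_taylor T0 subrr.
  - by move=> s; rewrite normrN; case: (IH s).
apply: (@taylor_bound_succ (sin \- sin_taylor N.+1)
    (fun s => cos s - cos_taylor N s)).
- by move=> s; apply: is_deriveB; exact: is_derive_sin_taylor.
- by rewrite /= sin0 /sin_taylor T0 subrr.
- by move=> s; case: (IH s).
Qed.

End trig_taylor.

(** * Fejer kernel and tent function *)

Section affine_substitution.
Context {R : realType}.
Local Notation leb := (@lebesgue_measure R).

Definition affine_map (a b : R) (x : measurableTypeR R) : measurableTypeR R :=
  a * x + b.

Lemma measurable_affine_map a b : measurable_fun setT (affine_map a b).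
Proof.
apply: measurable_funD => //; exact: measurable_funM.
Qed.

(** The pushforward of Lebesgue measure under [a x + b], scaled by [a], agrees with Lebesgue measure
    on half-open intervals, hence everywhere by uniqueness. *)
Lemma ge0_integral_affine (a b : R) (f : R -> \bar R) : 0 < a ->
  measurable_fun setT f -> (forall x, 0 <= f x)%E ->
  (\int[leb]_x f x = a%:E * \int[leb]_x f (a * x + b)%R)%E.
Proof.
move=> a0 mf f0; have mab := measurable_affine_map a b.
have := @ge0_integral_mscale _ _ _ leb setT measurableT (NngNum (ltW a0))
  (f \o affine_map a b).
rewrite {2}/affine_map/= => <-//; last exact: measurableT_comp.
rewrite -[RHS]/(\int[_]_(x in affine_map a b @^-1` setT)
  (f \o affine_map a b) x)%E.
rewrite -(ge0_integral_pushforward mab)//.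
apply: eq_measure_integral => A mA _.
apply: lebesgue_measure_unique => //= _ [[x y]] _ <-.
rewrite /mscale /pushforward/=.
rewrite (_ : affine_map a b @^-1` _ = `](x - b) / a, (y - b) / a]%classic).
  rewrite !lebesgue_measure_itv/= !lte_fin ltr_pM2r ?invr_gt0// ltrD2r.
  case: ifPn => _; last by rewrite mule0.
  by rewrite -EFinD -EFinM -mulrBl opprB addrA subrK mulrC divfK// gt_eqF.
apply/seteqP; split => t; rewrite /affine_map/= !in_itv/=;
  by rewrite ltr_pdivrMr// ler_pdivlMr// ltrBlDr lerBrDr mulrC.
Qed.

End affine_substitution.

Section bounded_factor.
Context {R : realType}.

Lemma integrable_mul_bounded d (T : measurableType d)
    (mu : {measure set T -> \bar R}) (D : set T) (f h : T -> R) :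
  measurable D -> mu.-integrable D (EFin \o f) -> measurable_fun D h ->
  (forall x, D x -> `|h x| <= 1) ->
  mu.-integrable D (EFin \o (fun x => f x * h x)).
Proof.
move=> mD fi mh h1; have mf := measurable_int _ fi.
apply: le_integrable fi => //.
  apply/measurable_EFinP; apply: measurable_funM => //.
  exact/measurable_EFinP.
by move=> x Dx; rewrite /= lee_fin normrM ler_piMr// h1.
Qed.

Lemma normr_cos_le1 (t : R) : `|cos t| <= 1.
Proof. by rewrite ler_norml cos_geN1 cos_le1. Qed.

Lemma normr_sin_le1 (t : R) : `|sin t| <= 1.
Proof. by rewrite ler_norml sin_geN1 sin_le1. Qed.

Lemma measurable_cos_comp d (T : measurableType d) (D : set T) (f : T -> R) :
  measurable_fun D f -> measurable_fun D (fun x => cos (f x)).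
Proof.
apply: measurableT_comp.
by apply: continuous_measurable_fun; exact: continuous_cos.
Qed.

Lemma measurable_sin_comp d (T : measurableType d) (D : set T) (f : T -> R) :
  measurable_fun D f -> measurable_fun D (fun x => sin (f x)).
Proof.
apply: measurableT_comp.
by apply: continuous_measurable_fun; exact: continuous_sin.
Qed.

End bounded_factor.

Section fejer.
Context {R : realType}.
Local Notation leb := (@lebesgue_measure R).
Implicit Types s t x y : R.

(* The second summand fills in the value at [0], where [(1 - cos t) / t ^+ 2] is
   the junk value [0]; it makes [sqr_fejer] and continuity hold there. *)
Definition fejer t : R := (1 - cos t) / t ^+ 2 + (t == 0)%:R / 2.

Lemma fejer0 : fejer 0 = 1 / 2.
Proof. by rewrite /fejer cos0 subrr mul0r eqxx add0r. Qed.

Lemma fejerE t : t != 0 -> fejer t = (1 - cos t) / t ^+ 2.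
Proof. by move=> /negPf t0; rewrite /fejer t0 mul0r addr0. Qed.

Lemma sqr_fejer t : t ^+ 2 * fejer t = 1 - cos t.
Proof.
have [->|t0] := eqVneq t 0; first by rewrite expr0n/= mul0r cos0 subrr.
by rewrite fejerE// mulrC divfK// expf_neq0.
Qed.

Lemma fejerN t : fejer (- t) = fejer t.
Proof. by rewrite /fejer cosN sqrrN oppr_eq0. Qed.

Lemma fejer_ge0 t : 0 <= fejer t.
Proof.
rewrite addr_ge0// ?divr_ge0 ?sqr_ge0// ?ler0n// subr_ge0; exact: cos_le1.
Qed.

(** The remainder of the cosine after four terms is at most [t ^ 4 / 4!]; dividing by [t ^ 2] leaves
    a factor [t ^ 2], which gives continuity at 0. *)
Lemma fejer_near0 t : `|fejer t - 1 / 2| <= t ^+ 2.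
Proof.
have [->|t0] := eqVneq t 0; first by rewrite fejer0 subrr normr0 sqr_ge0.
have [+ _] := trig_taylor_bound 4 t.
have -> : cos_taylor 4 t = 1 - t ^+ 2 / 2.
  rewrite /cos_taylor !big_ord_recr big_ord0/=.
  by rewrite -[0`!]/1%N -[1`!]/1%N -[2`!]/2%N -[3`!]/6%N; field.
have -> : `|t| ^+ 4 = t ^+ 2 * t ^+ 2.
  by rewrite -[4%N]/(2 * 2)%N exprM real_normK ?num_real// expr2.
rewrite fejerE// => h.
rewrite -(ler_pM2l (x := t ^+ 2)) ?exprn_even_gt0//.
rewrite -[X in X * `|_|]ger0_norm ?sqr_ge0// -normrM.
rewrite (_ : _ * (_ - _) = - (cos t - (1 - t ^+ 2 / 2))); last by field.
rewrite normrN.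
apply: le_trans h _; rewrite ler_pdivrMr ?ltr0n// ler_peMr ?ler1n//.
by rewrite -expr2 sqr_ge0.
Qed.

Lemma fejer_le_half t : fejer t <= 1 / 2.
Proof.
have [->|t0] := eqVneq t 0; first by rewrite fejer0.
have [+ _] := trig_taylor_bound 2 t.
have -> : cos_taylor 2 t = 1.
  by rewrite /cos_taylor !big_ord_recr big_ord0/= -[0`!]/1%N -[1`!]/1%N; field.
rewrite real_normK ?num_real// ler_norml lerBrDr => /andP[h _].
rewrite fejerE// ler_pdivrMr ?exprn_even_gt0//.
by move: h; rewrite -[2`!]/2%N; lra.
Qed.

(** An integrable majorant: [(1 + t ^ 2) * fejer t] equals [fejer t + (1 - cos t)], at most
    [1 / 2 + 2]. *)
Lemma fejer_le_oneDsqr t : fejer t <= 4 * (oneDsqr t)^-1.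
Proof.
rewrite ler_pdivlMr ?oneDsqr_gt0// /oneDsqr mulrDr mulr1 mulrC sqr_fejer.
have := fejer_le_half t; have := cos_geN1 t; lra.
Qed.

Lemma continuous_fejer : continuous fejer.
Proof.
move=> t; have [->|t0] := eqVneq t 0.
  rewrite /continuous_at fejer0; apply/cvgrPdist_le => e e0.
  have := @exprn_continuous R 2 0; rewrite /continuous_at expr0n/=.
  move=> /cvgrPdist_le/(_ e e0); apply: filterS => x.
  rewrite sub0r normrN ger0_norm ?sqr_ge0//.
  by apply: le_trans; rewrite distrC; exact: fejer_near0.
have F : (\near t, (1 - cos t) / t ^+ 2 = fejer t).
  by near=> x; rewrite fejerE//; near: x; exact: cvgr_neq0 t0.
rewrite /continuous_at fejerE//; apply: cvg_trans (near_eq_cvg F) _.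
apply: cvgM; first by apply: cvgB; [exact: cvg_cst|exact: continuous_cos].
by apply: cvgV; [rewrite expf_neq0|exact: exprn_continuous].
Unshelve. all: by end_near. Qed.

Lemma measurable_fejer : measurable_fun setT fejer.
Proof. by apply: continuous_measurable_fun; exact: continuous_fejer. Qed.

Lemma ge0_int_fejer_fin : (\int[leb]_x (fejer x)%:E < +oo)%E.
Proof.
apply: (@le_lt_trans _ _ (\int[leb]_x (4 * (oneDsqr x)^-1)%:E)%E).
  apply: ge0_le_integral => //=.
  - by move=> x _; rewrite lee_fin fejer_ge0.
  - by apply/measurable_EFinP; exact: measurable_fejer.
  - apply/measurable_EFinP; apply: measurable_funM => //.
    by apply: continuous_measurable_fun; exact: continuous_oneDsqrV.
  - by move=> x _; rewrite lee_fin fejer_le_oneDsqr.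
under eq_integral do rewrite EFinM.
rewrite ge0_integralZl//=; last first.
  by apply/measurable_EFinP; apply: continuous_measurable_fun;
    exact: continuous_oneDsqrV.
rewrite ge0_symfun_integralT.
- have -> : [set x : R | 0 <= x] = `[0, +oo[%classic.
    by apply/seteqP; split => x /=; rewrite in_itv/= andbT.
  by rewrite integral0y_oneDsqr -!EFinM ltry.
- by move=> x; rewrite invr_ge0 ltW ?oneDsqr_gt0.
- exact: continuous_oneDsqrV.
- by move=> x /=; rewrite /oneDsqr sqrrN.
Qed.

Lemma measurable_fejer_scale s :
  measurable_fun setT (fun x => s ^+ 2 * fejer (s * x)).
Proof.
apply: measurable_funM => //; apply: measurableT_comp; first exact: measurable_fejer.
exact: measurable_funM.
Qed.

(** The factor [s ^ 2] makes the integrand equal to [(1 - cos (s x)) / x ^ 2] away from 0, so the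
    result is homogeneous of degree one in [|s|] and holds for every sign of [s]. *)
Lemma integral_fejer_scale s : (\int[leb]_x (s ^+ 2 * fejer (s * x))%:E =
  `|s|%:E * \int[leb]_x (fejer x)%:E)%E.
Proof.
wlog s0 : s / 0 <= s => [h|].
  have [/h//|s0] := leP 0 s.
  rewrite -normrN -h ?oppr_ge0 1?ltW//.
  by apply: eq_integral => x _; rewrite sqrrN mulNr fejerN.
rewrite ger0_norm//; move: s0; rewrite le_eqVlt => /predU1P[<-|s0].
  rewrite mul0e; apply: integral0_eq => x _.
  by rewrite expr0n mul0r.
rewrite (ge0_integral_affine (f := EFin \o fejer) 0 s0)/=; last 2 first.
- by apply/measurable_EFinP; exact: measurable_fejer.
- by move=> x; rewrite lee_fin fejer_ge0.
rewrite muleA -EFinM -expr2 -ge0_integralZl//=.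
- by apply: eq_integral => x _; rewrite addr0 EFinM.
- apply/measurable_EFinP; apply: measurableT_comp; first exact: measurable_fejer.
  by apply: measurable_funD => //; exact: measurable_funM.
- by move=> x _; rewrite lee_fin fejer_ge0.
- by rewrite lee_fin sqr_ge0.
Qed.

Lemma integrable_fejer_scale s :
  leb.-integrable setT (EFin \o (fun x => s ^+ 2 * fejer (s * x))).
Proof.
apply/integrableP; split.
  by apply/measurable_EFinP; exact: measurable_fejer_scale.
under eq_integral do
  rewrite /= (ger0_norm (mulr_ge0 (sqr_ge0 _) (fejer_ge0 _))).
by rewrite integral_fejer_scale lte_mul_pinfty// ge0_int_fejer_fin.
Qed.

(** Classically the number pi; it is carried as a positive normalising factor. *)
Definition fejer_mass : R := \int[leb]_x fejer x.

Lemma Rintegral_fejer_scale s :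
  \int[leb]_x (s ^+ 2 * fejer (s * x)) = `|s| * fejer_mass.
Proof.
rewrite /Rintegral integral_fejer_scale fineM// ge0_fin_numE ?ge0_int_fejer_fin//.
by apply: integral_ge0 => x _; rewrite lee_fin fejer_ge0.
Qed.

Lemma fejer_ge_near0 t : `|t| <= 1 / 2 -> 1 / 4 <= fejer t.
Proof.
move=> t1; have := fejer_near0 t; rewrite ler_norml => /andP[+ _].
have : t ^+ 2 <= 1 / 4.
  rewrite -real_normK ?num_real//.
  by rewrite (le_trans (ler_pM _ _ t1 t1))//; lra.
lra.
Qed.

Lemma fejer_mass_gt0 : 0 < fejer_mass.
Proof.
rewrite /fejer_mass /Rintegral fine_gt0// ge0_int_fejer_fin andbT.
apply: (@lt_le_trans _ _ (\int[leb]_(x in `[(- (1 / 2))%R, (1 / 2)%R]) (1 / 4)%:E)%E).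
  rewrite integral_cst//= lebesgue_measure_itv/= lte_fin.
  by rewrite ifT; [rewrite -EFinD -EFinM lte_fin; lra|lra].
apply: (@le_trans _ _ (\int[leb]_(x in `[(- (1 / 2))%R, (1 / 2)%R]) (fejer x)%:E)%E).
  apply: ge0_le_integral => //=.
  - by apply/measurable_EFinP; apply: measurable_funTS; exact: measurable_fejer.
  - move=> x; rewrite in_itv/= -ler_norml => x1.
    by rewrite lee_fin fejer_ge_near0.
apply: ge0_subset_integral => //=.
- by apply/measurable_EFinP; exact: measurable_fejer.
- by move=> x _; rewrite lee_fin fejer_ge0.
Qed.

(** For [d >= 0] this is the maximum of [d - |y|] and 0, written as half a second difference of the
    absolute value, the form in which it comes out of the Fejer integrals. *)
Definition tent d y : R := (`|y + d| + `|y - d|) / 2 - `|y|.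

(* Since [\int (1 - cos (s x)) / x ^+ 2] is proportional to [`|s|], this identity
   yields the Fourier inversion of the tent function without any limit. *)
Lemma fejer_cos_expand d y x : d ^+ 2 * fejer (d * x) * cos (x * y) =
  1 / 2 * ((y + d) ^+ 2 * fejer ((y + d) * x)) +
  1 / 2 * ((y - d) ^+ 2 * fejer ((y - d) * x)) - y ^+ 2 * fejer (y * x).
Proof.
have [->|x0] := eqVneq x 0.
  by rewrite !(mulr0, mul0r) fejer0 cos0; field.
apply: (mulIf (expf_neq0 2 x0)).
have E s : s ^+ 2 * fejer (s * x) * x ^+ 2 = 1 - cos (s * x).
  by rewrite mulrAC -exprMn sqr_fejer.
rewrite mulrBl mulrDl -!(mulrA (1 / 2)) !E (mulrAC _ (cos _)) E.
have -> : (y + d) * x = y * x + d * x by ring.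
have -> : (y - d) * x = y * x - d * x by ring.
by rewrite (mulrC x y) cosD cosB; field.
Qed.

Lemma Rintegral_fejer_cos d y :
  \int[leb]_x (d ^+ 2 * fejer (d * x) * cos (x * y)) = fejer_mass * tent d y.
Proof.
under eq_Rintegral do rewrite fejer_cos_expand.
have Z k s : leb.-integrable setT
    (EFin \o (fun x => k * (s ^+ 2 * fejer (s * x)))).
  by have := integrableZl measurableT k (integrable_fejer_scale s).
rewrite RintegralB//=; last 2 first.
- have := integrableD measurableT (Z (1 / 2) (y + d)) (Z (1 / 2) (y - d)).
  exact.
- exact: integrable_fejer_scale.
have H k s : \int[leb]_x (k * (s ^+ 2 * fejer (s * x))) = k * (`|s| * fejer_mass).
  by rewrite RintegralZl ?Rintegral_fejer_scale//; exact: integrable_fejer_scale.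
by rewrite RintegralD// !H Rintegral_fejer_scale /tent; field.
Qed.

Lemma Rintegral_oppr (f : R -> R) : measurable_fun setT f ->
  leb.-integrable setT (fun x => (f (- x))%:E) ->
  \int[leb]_x f (- x) = \int[leb]_x f x.
Proof.
move=> mf fi; rewrite /Rintegral; congr fine.
have mN : measurable_fun setT (-%R : measurableTypeR R -> measurableTypeR R).
  exact: oppr_measurable.
have mEf : measurable_fun setT (EFin \o f) by exact/measurable_EFinP.
rewrite -[LHS](integral_pushforward mN mEf fi measurableT).
by apply/esym/eq_measure_integral => A mA _; exact/esym/lebesgue_measureN.
Qed.

Lemma Rintegral_fejer_sin d y :
  \int[leb]_x (d ^+ 2 * fejer (d * x) * sin (x * y)) = 0.
Proof.
pose f x := d ^+ 2 * fejer (d * x) * sin (x * y).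
have fi : leb.-integrable setT (EFin \o f).
  apply: (integrable_mul_bounded _ (integrable_fejer_scale d)) => //.
    by apply: measurable_sin_comp; exact: measurable_funM.
  by move=> x _; exact: normr_sin_le1.
have : \int[leb]_x f (- x) = - \int[leb]_x f x.
  rewrite -mulN1r -RintegralZl//; apply: eq_Rintegral => x _.
  by rewrite /f mulrN fejerN mulNr sinN mulrN mulN1r.
rewrite Rintegral_oppr//; last 2 first.
- by apply/measurable_EFinP; exact: measurable_int fi.
- rewrite (_ : (fun x => _) = -%E \o (EFin \o f)); first exact: integrableN.
  by apply/funext => x; rewrite /= /f mulrN fejerN mulNr sinN mulrN.
move=> /eqP.
by rewrite -addr_eq0 -mulr2n mulrn_eq0/= => /eqP.
Qed.

Lemma tent_ge0 d y : 0 <= tent d y.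
Proof.
have := ler_normD (y + d) (y - d); rewrite (_ : y + d + (y - d) = 2 * y); last by ring.
by rewrite normrM (ger0_norm (x := 2))// /tent; lra.
Qed.

Lemma tent_le d y : 0 <= d -> tent d y <= d.
Proof.
move=> d0; have := ler_normD y d; have := ler_normB y d; rewrite (ger0_norm d0) /tent.
lra.
Qed.

Lemma tent_eq0 d y : 0 <= d -> d <= `|y| -> tent d y = 0.
Proof.
move=> d0; rewrite /tent; have [y0|y0] := leP 0 y => dy.
  rewrite ger0_norm in dy => //; rewrite (ger0_norm y0).
  rewrite (ger0_norm (x := y + d)); last lra.
  by rewrite (ger0_norm (x := y - d)); lra.
rewrite ltr0_norm in dy => //; rewrite (ltr0_norm y0).
rewrite (ler0_norm (x := y + d)); last lra.
by rewrite (ler0_norm (x := y - d)); lra.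
Qed.

Lemma tent_scale d y : 0 <= d -> tent d (d * y) = d * tent 1 y.
Proof.
move=> d0; rewrite /tent (_ : d * y + d = d * (y + 1)); last by ring.
rewrite (_ : d * y - d = d * (y - 1)); last by ring.
by rewrite !normrM (ger0_norm d0); field.
Qed.

Lemma tentN d y : tent d (- y) = tent d y.
Proof.
rewrite /tent (_ : - y + d = - (y - d)); last by ring.
by rewrite (_ : - y - d = - (y + d)) ?normrN; [rewrite (addrC `|y - d|)|ring].
Qed.

Lemma measurable_tent d : measurable_fun setT (tent d).
Proof.
apply: measurable_funB; last exact: normr_measurable.
by apply: measurable_funM => //; apply: measurable_funD;
  apply: measurableT_comp => //; exact: measurable_funD.
Qed.

Lemma integral_tent1_gt0 : (0 < \int[leb]_x (tent 1 x)%:E)%E.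
Proof.
apply: (@lt_le_trans _ _ (\int[leb]_(x in `[(- (1 / 2))%R, (1 / 2)%R]) (1 / 2)%:E)%E).
  rewrite integral_cst//= lebesgue_measure_itv/= lte_fin.
  by rewrite ifT; [rewrite -EFinD -EFinM lte_fin; lra|lra].
apply: (@le_trans _ _ (\int[leb]_(x in `[(- (1 / 2))%R, (1 / 2)%R]) (tent 1 x)%:E)%E).
  apply: ge0_le_integral => //=.
  - by apply/measurable_EFinP; apply: measurable_funTS; exact: measurable_tent.
  - move=> x; rewrite in_itv/= -ler_norml => x1; rewrite lee_fin /tent.
    have : `|x| <= 1 / 2 := x1; rewrite ler_norml => /andP[x2 x3].
    rewrite (ger0_norm (x := x + 1)); last lra.
    rewrite (ler0_norm (x := x - 1)); last lra.
    by rewrite opprB; move: x1; lra.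
apply: ge0_subset_integral => //=.
- by apply/measurable_EFinP; exact: measurable_tent.
- by move=> x _; rewrite lee_fin tent_ge0.
Qed.

Lemma integral_tent1_fin : (\int[leb]_x (tent 1 x)%:E < +oo)%E.
Proof.
apply: (@le_lt_trans _ _ (\int[leb]_(x in `[(-1)%R, 1%R]) (cst 1%:E x))%E); last first.
  rewrite integral_cst//= lebesgue_measure_itv/= lte_fin.
  by rewrite ifT; [rewrite -EFinD -EFinM ltry|lra].
rewrite [leRHS]integral_mkcond/=; apply: ge0_le_integral => //=.
- by move=> x _; rewrite lee_fin tent_ge0.
- by apply/measurable_EFinP; exact: measurable_tent.
- by apply/(measurable_restrictT _ _).1.
- move=> x _; rewrite patchE; case: ifPn.
    by rewrite lee_fin tent_le.
  rewrite notin_setE/= in_itv/= -ler_norml => /negP; rewrite -ltNge => /ltW h.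
  by rewrite tent_eq0.
Qed.

Definition tent_mass : R := \int[leb]_x tent 1 x.

Lemma tent_mass_gt0 : 0 < tent_mass.
Proof. by rewrite fine_gt0// integral_tent1_fin integral_tent1_gt0. Qed.

Lemma integral_tent d a : 0 < d ->
  (\int[leb]_x (tent d (a - x))%:E = (d ^+ 2 * tent_mass)%:E)%E.
Proof.
move=> d0.
have E : (\int[leb]_x (tent 1 x)%:E = tent_mass%:E)%E.
  rewrite fineK// ge0_fin_numE ?integral_tent1_fin// ltW//.
  exact: integral_tent1_gt0.
rewrite EFinM -E; rewrite -invr_gt0 in d0.
(* Substitution in the integral of [tent 1], with slope [1 / d]; [d0] now states that the inverse of
   [d] is positive. *)
rewrite (ge0_integral_affine (f := EFin \o tent 1) (- (a / d)) d0)/=; last 2 first.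
- by apply/measurable_EFinP; exact: measurable_tent.
- by move=> x; rewrite lee_fin tent_ge0.
rewrite muleA -EFinM expr2 mulfK; last by rewrite -invr_eq0 gt_eqF.
rewrite -ge0_integralZl//=.
- apply: eq_integral => x _; rewrite -EFinM -tent_scale; last by rewrite -invr_ge0 ltW.
  rewrite -tentN; congr (tent _ _)%:E.
  by field; rewrite -invr_eq0 gt_eqF.
- apply/measurable_EFinP; apply: measurableT_comp; first exact: measurable_tent.
  by apply: measurable_funD => //; exact: measurable_funM.
- by move=> x _; rewrite lee_fin tent_ge0.
- by rewrite lee_fin -invr_ge0 ltW.
Qed.

End fejer.

(** * Integration on [R^d] *)

Section separated.
Context d1 d2 (T1 : measurableType d1) (T2 : measurableType d2) {R : realType}.
Variables (m1 : {sigma_finite_measure set T1 -> \bar R})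
  (m2 : {sigma_finite_measure set T2 -> \bar R}).
Variables (a : T1 -> R) (b : T2 -> R).
Hypotheses (ia : m1.-integrable setT (EFin \o a))
  (ib : m2.-integrable setT (EFin \o b)).

Lemma measurable_separated : measurable_fun setT (fun p : T1 * T2 => a p.1 * b p.2).
Proof.
apply: measurable_funM.
- apply: measurableT_comp; last exact: measurable_fst.
  by apply/measurable_EFinP; exact: measurable_int ia.
- apply: measurableT_comp; last exact: measurable_snd.
  by apply/measurable_EFinP; exact: measurable_int ib.
Qed.

Lemma integrable_separated :
  (m1 \x m2)%E.-integrable setT (EFin \o (fun p : T1 * T2 => a p.1 * b p.2)).
Proof.
apply/integrable12ltyP; first by apply/measurable_EFinP; exact: measurable_separated.
have /integrableP[ma ltya] := ia; have /integrableP[mb ltyb] := ib.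
have bfin : (\int[m2]_y `|(b y)%:E| \is a fin_num)%E.
  by rewrite ge0_fin_numE// integral_ge0.
rewrite (eq_integral (fun x => `|(a x)%:E| * \int[m2]_y `|(b y)%:E|))%E; last first.
  move=> x _; rewrite -ge0_integralZl//; last exact: measurableT_comp.
  by apply: eq_integral => y _; rewrite /= normrM EFinM.
rewrite -(fineK bfin) ge0_integralZr//=; last 2 first.
- by apply/measurable_EFinP; apply: measurableT_comp => //; exact/measurable_EFinP.
- by rewrite lee_fin fine_ge0// integral_ge0.
by rewrite fineK// lte_mul_pinfty ?integral_ge0 ?ge0_fin_numE ?integral_ge0//;
  rewrite -ge0_fin_numE ?integral_ge0.
Qed.

Lemma Rintegral_separated :
  \int[(m1 \x m2)%E]_p (a p.1 * b p.2) = \int[m1]_x a x * \int[m2]_y b y.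
Proof.
rewrite /Rintegral -fineM; [|exact: integrable_fin_num|exact: integrable_fin_num].
congr fine; rewrite -integral12_prod_meas1; last exact: integrable_separated.
rewrite /fubini_F/=.
under eq_integral => x _.
  under eq_integral do rewrite EFinM.
  rewrite integralZl//=.
  rewrite -(fineK (integrable_fin_num measurableT ib)).
  over.
by rewrite integralZr// fineK//; exact: integrable_fin_num.
Qed.

End separated.

Section integration_rV.
Context {R : realType}.
Local Notation leb := (@lebesgue_measure R).
Local Notation L := (@lebesgue_rV R).
Local Notation Rd d := 'rV[R]_d.

Lemma rV_cons0 d (p : measurableTypeR R * Rd d) : rV_cons p 0 ord0 = p.1.
Proof. by rewrite mxE unlift_none. Qed.

Lemma rV_consS d (p : measurableTypeR R * Rd d) j :
  rV_cons p 0 (lift ord0 j) = p.2 0 j.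
Proof. by rewrite mxE liftK. Qed.

Lemma integrable_rV_step d (F : Rd d.+1 -> R) : measurable_fun setT F ->
  (leb \x L d)%E.-integrable setT (fun p => (F (rV_cons p))%:E) ->
  (L d.+1).-integrable setT (EFin \o F).
Proof.
move=> mF iF; apply: (integrable_pushforward (measurable_rV_cons (d := d))) => //.
exact/measurable_EFinP.
Qed.

Lemma Rintegral_rV_step d (F : Rd d.+1 -> R) : measurable_fun setT F ->
  (leb \x L d)%E.-integrable setT (fun p => (F (rV_cons p))%:E) ->
  \int[L d.+1]_v F v = \int[(leb \x L d)%E]_p F (rV_cons p).
Proof.
move=> mF iF; congr fine.
apply: (integral_pushforward (measurable_rV_cons (d := d))) => //.
exact/measurable_EFinP.
Qed.

(** The space of dimension 0 is a single point carrying a Dirac mass; this is the base case of the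
    inductions on [d] below. *)
Lemma fun_rV0 (F : Rd 0 -> R) : F = cst (F 0).
Proof. by apply/funext => v; congr F; rewrite thinmx0. Qed.

Lemma Rintegral_rV0 (F : Rd 0 -> R) : \int[L 0]_v F v = F 0.
Proof.
rewrite (fun_rV0 F) /Rintegral/=.
by rewrite (@integral_dirac _ _ (0 : Rd 0) R)//= indicT mul1r.
Qed.

Lemma integrable_rV0 (F : Rd 0 -> R) : (L 0).-integrable setT (EFin \o F).
Proof.
rewrite (fun_rV0 F); apply/integrableP; split; first exact/measurable_EFinP.
by rewrite /= (@integral_dirac _ _ (0 : Rd 0) R)//= diracT mul1e ltry.
Qed.

Lemma measurable_prod_rV d (k : 'I_d -> R -> R) :
  (forall i, measurable_fun setT (k i)) ->
  measurable_fun setT (fun v : Rd d => \prod_(i < d) k i (v 0 i)).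
Proof.
move=> mk; apply: measurable_prod => i _.
by apply: measurableT_comp => //; exact: measurable_coord.
Qed.

Lemma measurable_dotrV d (z : Rd d) : measurable_fun setT (fun v : Rd d => dotrV v z).
Proof.
apply: measurable_sum => i; apply: measurable_funM => //; exact: measurable_coord.
Qed.

Lemma prod_rV_cons d (k : 'I_d.+1 -> R -> R) (p : measurableTypeR R * Rd d) :
  \prod_(i < d.+1) k i (rV_cons p 0 i) =
  k ord0 p.1 * \prod_(i < d) k (lift ord0 i) (p.2 0 i).
Proof.
rewrite big_ord_recl rV_cons0; congr (_ * _).
by apply: eq_bigr => i _; rewrite rV_consS.
Qed.

Lemma integrable_prod_rV d (k : 'I_d -> R -> R) :
  (forall i, leb.-integrable setT (EFin \o k i)) ->
  (L d).-integrable setT (EFin \o (fun v => \prod_(i < d) k i (v 0 i))).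
Proof.
elim: d k => [|d IH] k ik; first exact: integrable_rV0.
apply: integrable_rV_step.
  by apply: measurable_prod_rV => i; apply/measurable_EFinP; exact: measurable_int (ik i).
under eq_fun do rewrite prod_rV_cons.
have := integrable_separated (ik ord0) (IH _ (fun i => ik (lift ord0 i))).
exact.
Qed.

Lemma Rintegral_prod_rV d (k : 'I_d -> R -> R) :
  (forall i, leb.-integrable setT (EFin \o k i)) ->
  \int[L d]_v (\prod_(i < d) k i (v 0 i)) = \prod_(i < d) \int[leb]_t k i t.
Proof.
elim: d k => [|d IH] k ik; first by rewrite Rintegral_rV0 !big_ord0.
have mk i : measurable_fun setT (k i).
  by apply/measurable_EFinP; exact: measurable_int (ik i).
have ik' := integrable_prod_rV (fun i => ik (lift ord0 i)).
rewrite Rintegral_rV_step; [|exact: measurable_prod_rV|]; last first.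
  by under eq_fun do rewrite prod_rV_cons; exact: (integrable_separated (ik ord0) ik').
under eq_Rintegral do rewrite prod_rV_cons.
rewrite (Rintegral_separated (ik ord0) ik') big_ord_recl.
by congr (_ * _); exact: (IH _ (fun i => ik (lift ord0 i))).
Qed.

Lemma dotrV_cons d (p : measurableTypeR R * Rd d) (z : Rd d.+1) :
  dotrV (rV_cons p) z = p.1 * z 0 ord0 + dotrV p.2 (\row_j z 0 (lift ord0 j)).
Proof.
rewrite /dotrV big_ord_recl rV_cons0; congr (_ + _).
by apply: eq_bigr => i _; rewrite rV_consS mxE.
Qed.

(** The cosine of a dot product is not a product, but the addition formula splits off the first
    coordinate into two separated terms, and the sine term integrates to zero by hypothesis. *)
Lemma Rintegral_prod_cos_rV d (k : 'I_d -> R -> R) (z : Rd d) :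
  (forall i, leb.-integrable setT (EFin \o k i)) ->
  (forall i, \int[leb]_t (k i t * sin (t * z 0 i)) = 0) ->
  \int[L d]_v (\prod_(i < d) k i (v 0 i) * cos (dotrV v z)) =
  \prod_(i < d) \int[leb]_t (k i t * cos (t * z 0 i)).
Proof.
elim: d k z => [|d IH] k z ik k0.
  by rewrite Rintegral_rV0 !big_ord0 /dotrV big_ord0 cos0 mulr1.
have mk i : measurable_fun setT (k i).
  by apply/measurable_EFinP; exact: measurable_int (ik i).
have ik' := integrable_prod_rV (fun i => ik (lift ord0 i)).
pose z' : Rd d := \row_j z 0 (lift ord0 j).
pose P (v : Rd d) := \prod_(i < d) k (lift ord0 i) (v 0 i).
have E p : \prod_(i < d.+1) k i (rV_cons p 0 i) * cos (dotrV (rV_cons p) z) =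
    (k ord0 p.1 * cos (p.1 * z 0 ord0)) * (P p.2 * cos (dotrV p.2 z')) -
    (k ord0 p.1 * sin (p.1 * z 0 ord0)) * (P p.2 * sin (dotrV p.2 z')).
  by rewrite prod_rV_cons dotrV_cons cosD /P; ring.
have mt : measurable_fun setT (fun t : measurableTypeR R => t * z 0 ord0).
  exact: measurable_funM.
have ic : leb.-integrable setT (EFin \o (fun t => k ord0 t * cos (t * z 0 ord0))).
  apply: integrable_mul_bounded => //; first exact: measurable_cos_comp.
  by move=> t _; exact: normr_cos_le1.
have is_ : leb.-integrable setT (EFin \o (fun t => k ord0 t * sin (t * z 0 ord0))).
  apply: integrable_mul_bounded => //; first exact: measurable_sin_comp.
  by move=> t _; exact: normr_sin_le1.
have iC : (L d).-integrable setT (EFin \o (fun v => P v * cos (dotrV v z'))).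
  apply: integrable_mul_bounded => //.
    by apply: measurable_cos_comp; exact: measurable_dotrV.
  by move=> v _; exact: normr_cos_le1.
have iS : (L d).-integrable setT (EFin \o (fun v => P v * sin (dotrV v z'))).
  apply: integrable_mul_bounded => //.
    by apply: measurable_sin_comp; exact: measurable_dotrV.
  by move=> v _; exact: normr_sin_le1.
have sC := integrable_separated ic iC; have sS := integrable_separated is_ iS.
rewrite Rintegral_rV_step; last 2 first.
- apply: measurable_funM; first exact: measurable_prod_rV.
  by apply: measurable_cos_comp; exact: measurable_dotrV.
- by under eq_fun do rewrite E EFinB; exact: (integrableB measurableT sC sS).
under eq_Rintegral do rewrite E.
rewrite (RintegralB measurableT sC sS) (Rintegral_separated ic iC).
rewrite (Rintegral_separated is_ iS) k0 mul0r subr0 big_ord_recl.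
congr (_ * _); rewrite /P (IH (fun i => k (lift ord0 i)))//; last first.
  by move=> i; rewrite mxE.
by apply: eq_bigr => i _; rewrite mxE.
Qed.

End integration_rV.

(** * Fourier inversion *)

Section fourier_inversion.
Context {R : realType} (d : nat).
Local Notation leb := (@lebesgue_measure R).
Local Notation L := (lebesgue_rV R d).
Local Notation Rd := 'rV[R]_d.
Implicit Types (u : Rd -> R) (x y xi : Rd).

Lemma dotrVB xi x y : dotrV xi (x - y) = dotrV xi x - dotrV xi y.
Proof.
rewrite /dotrV -sumrB; apply: eq_bigr => i _.
by rewrite !mxE mulrBr.
Qed.

Definition cos_transform u xi : R := \int[L]_y (u y * cos (dotrV xi y)).
Definition sin_transform u xi : R := \int[L]_y (u y * sin (dotrV xi y)).

(** Integrability is required on every section, so that [fine] in each inner real integral is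
    applied to a finite value. *)
Lemma Rintegral_Fubini d1 d2 (T1 : measurableType d1) (T2 : measurableType d2)
    (m1 : {sigma_finite_measure set T1 -> \bar R})
    (m2 : {sigma_finite_measure set T2 -> \bar R}) (F : T1 * T2 -> R) :
  (m1 \x m2)%E.-integrable setT (EFin \o F) ->
  (forall s, m2.-integrable setT (fun t => (F (s, t))%:E)) ->
  (forall t, m1.-integrable setT (fun s => (F (s, t))%:E)) ->
  \int[m1]_s \int[m2]_t F (s, t) = \int[m2]_t \int[m1]_s F (s, t).
Proof.
move=> iF i1 i2; rewrite /Rintegral; congr fine.
under eq_integral => s _.
  rewrite fineK; last exact: integrable_fin_num (i1 s).
  over.
rewrite (Fubini iF); apply: eq_integral => t _.
by rewrite fineK//; exact: integrable_fin_num (i2 t).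
Qed.

Lemma measurable_dotrV_snd_fst :
  measurable_fun setT (fun p : Rd * Rd => dotrV p.2 p.1).
Proof.
apply: measurable_sum => i; apply: measurable_funM.
- by apply: (measurableT_comp (measurable_coord i)); exact: measurable_snd.
- by apply: (measurableT_comp (measurable_coord i)); exact: measurable_fst.
Qed.

Lemma measurable_dotrVr xi : measurable_fun setT (fun y : Rd => dotrV xi y).
Proof.
apply: measurable_sum => i; apply: measurable_funM => //; exact: measurable_coord.
Qed.

Section tent_pairing.
Variables (u : Rd -> R) (iu : L.-integrable setT (EFin \o u)).

Lemma integrable_mul_cos xi :
  L.-integrable setT (EFin \o (fun y => u y * cos (dotrV xi y))).
Proof.
apply: integrable_mul_bounded => //.
  by apply: measurable_cos_comp; exact: measurable_dotrVr.
by move=> y _; exact: normr_cos_le1.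
Qed.

Lemma integrable_mul_sin xi :
  L.-integrable setT (EFin \o (fun y => u y * sin (dotrV xi y))).
Proof.
apply: integrable_mul_bounded => //.
  by apply: measurable_sin_comp; exact: measurable_dotrVr.
by move=> y _; exact: normr_sin_le1.
Qed.

Lemma normr_transform_le (h : Rd -> R) : measurable_fun setT h ->
  (forall y, `|h y| <= 1) ->
  `|\int[L]_y (u y * h y)| <= \int[L]_y `|u y|.
Proof.
move=> mh h1.
have iuh : L.-integrable setT (EFin \o (fun y => u y * h y)).
  by apply: integrable_mul_bounded.
apply: (le_trans (le_normr_Rintegral measurableT iuh)).
apply: le_Rintegral => //.
- exact: (integrable_norm iuh).
- exact: (integrable_norm iu).
- by move=> y _; rewrite normrM ler_piMr.
Qed.

Lemma normr_cos_transform_le xi : `|cos_transform u xi| <= \int[L]_y `|u y|.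
Proof.
apply: normr_transform_le => [|y]; last exact: normr_cos_le1.
by apply: measurable_cos_comp; exact: measurable_dotrVr.
Qed.

Lemma normr_sin_transform_le xi : `|sin_transform u xi| <= \int[L]_y `|u y|.
Proof.
apply: normr_transform_le => [|y]; last exact: normr_sin_le1.
by apply: measurable_sin_comp; exact: measurable_dotrVr.
Qed.

(** An exact identity for every [e]: write each tent as a cosine integral of a Fejer kernel,
    exchange the integrals, and expand the cosine of [xi . (x - y)]. *)
Lemma tent_pairing (e : R) x :
  \int[L]_y (u y * \prod_(i < d) (fejer_mass * tent e (x 0 i - y 0 i))) =
  \int[L]_xi ((\prod_(i < d) (e ^+ 2 * fejer (e * xi 0 i))) *
    (cos (dotrV xi x) * cos_transform u xi + sin (dotrV xi x) * sin_transform u xi)).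
Proof.
pose K xi := \prod_(i < d) (e ^+ 2 * fejer (e * xi 0 i)).
have iK : L.-integrable setT (EFin \o K).
  by apply: (integrable_prod_rV (k := fun _ t => e ^+ 2 * fejer (e * t))) => i;
    exact: integrable_fejer_scale.
have E y : \prod_(i < d) (fejer_mass * tent e (x 0 i - y 0 i)) =
    \int[L]_xi (K xi * cos (dotrV xi (x - y))).
  rewrite (Rintegral_prod_cos_rV (k := fun _ t => e ^+ 2 * fejer (e * t))).
  - by apply: eq_bigr => i _; rewrite Rintegral_fejer_cos !mxE.
  - by move=> i; exact: integrable_fejer_scale.
  - by move=> i; exact: Rintegral_fejer_sin.
pose F (p : Rd * Rd) := u p.1 * K p.2 * cos (dotrV p.2 (x - p.1)).
have mdot : measurable_fun setT (fun p : Rd * Rd => dotrV p.2 (x - p.1)).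
  under eq_fun do rewrite dotrVB.
  apply: measurable_funB; last exact: measurable_dotrV_snd_fst.
  apply: (measurableT_comp (measurable_dotrV x)); exact: measurable_snd.
(* The Fejer product is integrable in [xi] and [u] in [y]; the cosine is a bounded factor. *)
have iF : (L \x L)%E.-integrable setT (EFin \o F).
  apply: integrable_mul_bounded => //.
  - exact: (integrable_separated iu iK).
  - exact: measurable_cos_comp.
  - by move=> p _; exact: normr_cos_le1.
have mK : measurable_fun setT K by apply/measurable_EFinP; exact: measurable_int iK.
have iKc y : L.-integrable setT (EFin \o (fun xi => K xi * cos (dotrV xi (x - y)))).
  apply: integrable_mul_bounded => //.
  - by apply: measurable_cos_comp; exact: measurable_dotrV.
  - by move=> p _; exact: normr_cos_le1.
transitivity (\int[L]_y \int[L]_xi F (y, xi)).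
  apply: eq_Rintegral => y _; rewrite E -RintegralZl//.
  by apply: eq_Rintegral => xi _; rewrite /F mulrA.
have EF y xi : F (y, xi) = K xi * cos (dotrV xi x) * (u y * cos (dotrV xi y)) +
    K xi * sin (dotrV xi x) * (u y * sin (dotrV xi y)).
  by rewrite /F/= dotrVB cosB; ring.
have Zc k xi := integrableZl measurableT k (integrable_mul_cos xi).
have Zs k xi := integrableZl measurableT k (integrable_mul_sin xi).
rewrite Rintegral_Fubini//.
- apply: eq_Rintegral => xi _.
  under eq_Rintegral do rewrite EF.
  rewrite (RintegralD measurableT (Zc _ _) (Zs _ _)).
  rewrite (RintegralZl _ measurableT (integrable_mul_cos xi)).
  rewrite (RintegralZl _ measurableT (integrable_mul_sin xi)).
  by rewrite /cos_transform /sin_transform mulrDr !mulrA.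
- move=> y; have := integrableZl measurableT (u y) (iKc y).
  apply: eq_integrable => // xi _ /=.
  by rewrite /F/= -EFinM mulrA.
- move=> xi; under eq_fun do rewrite EF EFinD.
  exact: (integrableD measurableT (Zc _ _) (Zs _ _)).
Qed.

End tent_pairing.

End fourier_inversion.

(** * Limits of the two sides of the tent pairing *)

Section inversion_limit.
Context {R : realType} (d : nat).
Local Notation leb := (@lebesgue_measure R).
Local Notation L := (lebesgue_rV R d).
Local Notation Rd := 'rV[R]_d.
Implicit Types (u G : Rd -> R) (x y xi : Rd).

Lemma measurable_cube (s : R) : measurable (cube s : set Rd).
Proof.
rewrite (_ : cube s = \bigcap_(i in [set: 'I_d])
    ((fun v : Rd => v 0 i : measurableTypeR R) @^-1` [set t | `|t| <= s])).
  apply: fin_bigcap_measurable => // i _; rewrite -[X in measurable X]setTI.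
  apply: measurable_coord => //.
  rewrite (_ : [set t | _] = `[- s, s]%classic)//.
  by apply/seteqP; split => t /=; rewrite in_itv/= ler_norml.
by apply/seteqP; split => v /= h i; [move=> _; exact: h|exact: h].
Qed.

Lemma lebesgue_cube_fin (s : R) : (L (cube s : set Rd) < +oo)%E.
Proof.
rewrite (_ : cube s = [set v : Rd | forall i, `[- s, s]%classic (v 0 i)]).
  rewrite (lebesgue_rV_box (A := fun=> `[- s, s]%classic))//.
  rewrite ltey_eq; apply/orP; left.
  apply: (big_ind (fun a : \bar R => a \is a fin_num)) => //.
    exact: fin_numM.
  by move=> i _; rewrite lebesgue_measure_itv/=; case: ifPn.
by apply/seteqP; split => v /= h i; have := h i; rewrite in_itv/= ler_norml.
Qed.

Lemma Rintegral_tent (e a : R) : 0 < e ->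
  leb.-integrable setT (EFin \o (fun t => fejer_mass * tent e (a - t))) /\
  \int[leb]_t (fejer_mass * tent e (a - t)) = fejer_mass * tent_mass * e ^+ 2.
Proof.
move=> e0.
have iT : leb.-integrable setT (EFin \o (fun t => tent e (a - t))).
  apply/integrableP; split.
    apply/measurable_EFinP; apply: measurableT_comp; first exact: measurable_tent.
    exact: measurable_funB.
  under eq_integral do rewrite /= (ger0_norm (tent_ge0 _ _)).
  by rewrite integral_tent// ltry.
split; first exact: (integrableZl measurableT _ iT).
rewrite RintegralZl// -mulrA; congr (_ * _).
by rewrite /Rintegral integral_tent//= mulrC.
Qed.

(** The tent products are an approximate identity: nonnegative, of total mass
    [(fejer_mass * tent_mass * e ^ 2) ^ d], and zero unless every coordinate of [y] is within [e] of
    that of [x]. *)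
Lemma tent_average u x : L.-integrable setT (EFin \o u) -> {for x, continuous u} ->
  (\int[L]_y (u y * \prod_(i < d) (fejer_mass * tent e (x 0 i - y 0 i)))
    / (e ^+ 2) ^+ d) @[e --> 0^'+] --> u x * (fejer_mass * tent_mass) ^+ d.
Proof.
move=> iu cu; pose w : R := (fejer_mass * tent_mass) ^+ d.
have w0 : 0 < w by rewrite exprn_gt0// mulr_gt0 ?fejer_mass_gt0 ?tent_mass_gt0.
apply/cvgrPdist_le => r r0.
have rw : 0 < r / w by rewrite divr_gt0.
have /nbhs_ballP[a /= a0 ua] : \forall y \near x, `|u x - u y| <= r / w.
  by move/cvgrPdist_le : cu; apply.
near=> e.
have e0 : 0 < e by near: e; exact: nbhs_right_gt.
have ea : e <= a by near: e; exact: nbhs_right_le.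
pose T y := \prod_(i < d) (fejer_mass * tent e (x 0 i - y 0 i)).
have iT : L.-integrable setT (EFin \o T).
  apply: (integrable_prod_rV (k := fun i t => fejer_mass * tent e (x 0 i - t))) => i.
  exact: (Rintegral_tent _ e0).1.
have IT : \int[L]_y T y = w * (e ^+ 2) ^+ d.
  rewrite (Rintegral_prod_rV (k := fun i t => fejer_mass * tent e (x 0 i - t))).
    rewrite -exprMn -[in RHS](card_ord d) -prodr_const; apply: eq_bigr => i _.
    exact: (Rintegral_tent _ e0).2.
  by move=> i; exact: (Rintegral_tent _ e0).1.
have T0 y : 0 <= T y.
  by apply: prodr_ge0 => i _; rewrite mulr_ge0 ?tent_ge0// ltW// fejer_mass_gt0.
have mT : measurable_fun setT T by apply/measurable_EFinP; exact: measurable_int iT.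
have tent_le' i y : fejer_mass * tent e (x 0 i - y 0 i) <= fejer_mass * e.
  by rewrite ler_pM2l ?fejer_mass_gt0// tent_le// ltW.
have iuT : L.-integrable setT (EFin \o (fun y => u y * T y)).
  (* Rescaling by a bound [M] of [T] brings the product into the form of [integrable_mul_bounded],
     whose second factor is at most 1. *)
  have [M] : exists M, 0 < M /\ forall y, T y <= M.
    exists ((fejer_mass * e) ^+ d); split.
      by rewrite exprn_gt0// mulr_gt0 ?fejer_mass_gt0.
    move=> y; rewrite -[in leRHS](card_ord d) -prodr_const; apply: ler_prod => i _.
    by rewrite tent_le' mulr_ge0 ?tent_ge0// ltW// fejer_mass_gt0.
  move=> [M0 TM]; rewrite (_ : _ \o _ = EFin \o (fun y => M * u y * (T y / M))).
    apply: integrable_mul_bounded => //.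
    - exact: (integrableZl measurableT M iu).
    - exact: measurable_funM.
    - move=> y _; rewrite ger0_norm ?divr_ge0 ?T0 ?(ltW M0)//.
      by rewrite ler_pdivrMr ?mul1r.
  by apply/funext => y /=; congr EFin; field; rewrite gt_eqF.
rewrite -/(T _) -(ler_pM2r (_ : 0 < (e ^+ 2) ^+ d)) ?exprn_gt0//.
rewrite -[X in _ * X <= _]ger0_norm ?exprn_ge0 ?(ltW e0)//.
rewrite -normrM mulrBl divfK; last first.
  by rewrite expf_neq0// expf_neq0// gt_eqF.
rewrite -mulrA -/w -IT -RintegralZl//.
rewrite -RintegralB//; last first.
  exact: (integrableZl measurableT (u x) iT).
have iD : L.-integrable setT (EFin \o (fun y => u x * T y - u y * T y)).
  by have := integrableB measurableT (integrableZl measurableT (u x) iT) iuT.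
apply: (le_trans (le_normr_Rintegral measurableT iD)).
rewrite -[r in leRHS](divfK (lt0r_neq0 w0)) -(mulrA (r / w)) -IT -RintegralZl//.
apply: le_Rintegral => //.
- exact: (integrable_norm iD).
- exact: (integrableZl measurableT (r / w) iT).
move=> y _; rewrite -mulrBl normrM (ger0_norm (T0 y)).
(* Where [T y] is nonzero, [y] lies in the sup-norm ball of radius [a] on which [u] is close to
   [u x]. *)
have [->|Ty] := eqVneq (T y) 0; first by rewrite !mulr0.
rewrite ler_wpM2r//; apply: ua; split => // i j; rewrite ord1 /ball/=.
rewrite (lt_le_trans _ ea)// ltNge; apply/negP => h; move/negP : Ty; apply.
by rewrite /T (bigD1 j)//= tent_eq0 ?(ltW e0)// mulr0 mul0r.
Unshelve. all: by end_near. Qed.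

Lemma cube_bounded_integrable s M G : measurable_fun setT G ->
  (forall xi, `|G xi| <= M) -> L.-integrable (cube s) (EFin \o G).
Proof.
move=> mG GM; apply: measurable_bounded_integrable.
- exact: measurable_cube.
- exact: lebesgue_cube_fin.
- exact: measurable_funTS.
- exists M; split; first exact: num_real.
  by move=> N MN xi _ /=; rewrite (le_trans (GM xi))// ltW.
Qed.

(** After division by the powers of the scale, the kernel is bounded by 1 and tends to
    [fejer 0 ^ d]. The scale is the sequence [harmonic] so that dominated convergence applies, with
    [M] as majorant on the cube. *)
Lemma fejer_average (s M : R) G : measurable_fun setT G ->
  (forall xi, `|G xi| <= M) -> (forall xi, ~ cube s xi -> G xi = 0) ->
  (\int[L]_xi ((\prod_(i < d)
      (harmonic n ^+ 2 * fejer (harmonic n * xi 0 i))) * G xi)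
    / (harmonic n ^+ 2) ^+ d) @[n --> \oo] -->
  (1 / 2) ^+ d * \int[L]_(xi in cube s) G xi.
Proof.
move=> mG GM G0; have mC := measurable_cube s.
have iP n : (measurable_fun setT (fun xi => \prod_(i < d) fejer (harmonic n * xi 0 i)) /\
    (forall xi, `|\prod_(i < d) fejer (harmonic n * xi 0 i)| <= 1)) /\
    L.-integrable (cube s)
      (EFin \o (fun xi => (\prod_(i < d) fejer (harmonic n * xi 0 i)) * G xi)).
  have m1 : measurable_fun setT (fun xi => \prod_(i < d) fejer (harmonic n * xi 0 i)).
    apply: (measurable_prod_rV (k := fun _ t => fejer (harmonic n * t))) => i.
    apply: measurableT_comp; first exact: measurable_fejer.
    exact: measurable_funM.
  have m2 xi : `|\prod_(i < d) fejer (harmonic n * xi 0 i)| <= 1.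
    rewrite normr_prod; apply: prodr_ile1 => i _; rewrite normr_ge0/=.
    rewrite ger0_norm ?fejer_ge0// (le_trans (fejer_le_half _))//; lra.
  split => //; apply: (@cube_bounded_integrable s M).
    exact: measurable_funM.
  by move=> xi; rewrite normrM (le_trans _ (GM xi))// ler_piMl.
have Ceq n : \int[L]_xi ((\prod_(i < d)
      (harmonic n ^+ 2 * fejer (harmonic n * xi 0 i))) * G xi)
    / (harmonic n ^+ 2) ^+ d = \int[L]_(xi in cube s)
      ((\prod_(i < d) fejer (harmonic n * xi 0 i)) * G xi).
  transitivity ((\int[L]_(xi in cube s) ((harmonic n ^+ 2) ^+ d *
      ((\prod_(i < d) fejer (harmonic n * xi 0 i)) * G xi))) / (harmonic n ^+ 2) ^+ d).
    congr (_ / _); rewrite [RHS]Rintegral_mkcond; apply: eq_Rintegral => xi _.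
    rewrite patchE; case: ifPn => [_|]; last first.
      by rewrite notin_setE => /G0 ->; rewrite mulr0.
    by rewrite big_split/= prodr_const card_ord mulrA.
  rewrite RintegralZl//; first by rewrite mulrC mulKf// !expf_neq0// invr_eq0 pnatr_eq0.
  exact: (iP n).2.
under eq_cvg do rewrite Ceq.
have -> : (1 / 2) ^+ d * \int[L]_(xi in cube s) G xi =
    \int[L]_(xi in cube s) ((1 / 2) ^+ d * G xi).
  by rewrite RintegralZl//; exact: (cube_bounded_integrable s mG GM).
apply: fine_cvg; rewrite fineK; last first.
  apply: integrable_fin_num => //.
  exact: (integrableZl mC _ (cube_bounded_integrable _ mG GM)).
apply: (@dominated_cvg _ _ _ _ _ mC
  (fun n xi => ((\prod_(i < d) fejer (harmonic n * xi 0 i)) * G xi)%:E) _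
  (cst M%:E)).
- move=> n; apply/measurable_EFinP; apply: measurable_funTS; apply: measurable_funM => //.
  exact: (iP n).1.1.
- move=> xi _; apply: cvg_EFin; first exact: nearW.
  apply: cvgMr_tmp; rewrite -[in X in _ --> X](card_ord d) -prodr_const.
  apply: (cvg_big (x0 := 1 : R)) => [|i _]; first exact: mul_continuous.
  rewrite -fejer0; apply: continuous_cvg; first exact: continuous_fejer.
  rewrite -[X in _ --> X](mul0r (xi 0 i)); apply: cvgMr_tmp; exact: cvg_harmonic.
- by [].
- by apply: (@cube_bounded_integrable s `|M| (cst M)).
- move=> n xi _; rewrite /= lee_fin normrM.
  by rewrite (le_trans _ (GM xi))// ler_piMl//; exact: (iP n).1.2.
Qed.

End inversion_limit.

Section inversion.
Context {R : realType} (d : nat).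
Local Notation L := (lebesgue_rV R d).
Local Notation Rd := 'rV[R]_d.
Implicit Types (u : Rd -> R) (x y xi : Rd).

(** Measurability is that of a Fubini marginal. The indicator of the cube makes the function of two
    variables integrable, and leaves the marginal unchanged since the transform vanishes off the
    cube. *)
Lemma measurable_transform u s (h : R -> R) : L.-integrable setT (EFin \o u) ->
  measurable_fun setT h -> (forall t, `|h t| <= 1) ->
  (forall xi, ~ cube s xi -> \int[L]_y (u y * h (dotrV xi y)) = 0) ->
  measurable_fun setT (fun xi => \int[L]_y (u y * h (dotrV xi y))).
Proof.
move=> iu mh h1 h0.
pose F (p : Rd * Rd) := u p.1 * \1_(cube s) p.2 * h (dotrV p.2 p.1).
have iF : (L \x L)%E.-integrable setT (EFin \o F).
  apply: integrable_mul_bounded => //.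
    apply: (integrable_separated iu).
    apply/integrableP; split.
      by apply/measurable_EFinP; apply: measurable_indic; exact: measurable_cube.
    under eq_integral do rewrite /= (ger0_norm (ler0n _ _)).
    rewrite integral_indic ?setIT//; first exact: lebesgue_cube_fin.
    exact: measurable_cube.
  by apply: measurableT_comp => //; exact: measurable_dotrV_snd_fst.
have := measurable_fubini_G iF; rewrite (_ : fubini_G _ _ =
  EFin \o (fun xi => \int[L]_y (u y * h (dotrV xi y)))); first by move/measurable_EFinP.
apply/funext => xi; rewrite /fubini_G/=.
have [cxi|ncxi] := pselect (cube s xi).
  under eq_integral do rewrite /F/= indicE mem_set// mulr1.
  rewrite fineK//; apply: integrable_fin_num => //.
  apply: integrable_mul_bounded => //.
  by apply: measurableT_comp => //; exact: measurable_dotrVr.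
rewrite h0//; apply: integral0_eq => y _.
by rewrite /F/= indicE memNset// mulr0 mul0r.
Qed.

Lemma band_limited_inversion u s : L.-integrable setT (EFin \o u) -> continuous u ->
  (forall xi, ~ cube s xi -> cos_transform u xi = 0 /\ sin_transform u xi = 0) ->
  exists (U V : Rd -> R) (M : R), [/\ measurable_fun setT U, measurable_fun setT V,
    (forall xi, `|U xi| <= M /\ `|V xi| <= M) &
    forall x, u x =
      \int[L]_(xi in cube s) (cos (dotrV xi x) * U xi + sin (dotrV xi x) * V xi)].
Proof.
move=> iu cu u0.
have mC : measurable_fun setT (cos_transform u).
  apply: (measurable_transform (s := s) iu) => [|t|xi /u0[]//].
    by apply: continuous_measurable_fun; exact: continuous_cos.
  exact: normr_cos_le1.
have mS : measurable_fun setT (sin_transform u).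
  apply: (measurable_transform (s := s) iu) => [|t|xi /u0[]//].
    by apply: continuous_measurable_fun; exact: continuous_sin.
  exact: normr_sin_le1.
pose w : R := (fejer_mass * tent_mass) ^+ d.
have w0 : 0 < w by rewrite exprn_gt0// mulr_gt0 ?fejer_mass_gt0 ?tent_mass_gt0.
(* This is the usual factor [(2 pi) ^ - d], since [fejer_mass] is pi and [tent_mass] is 1. *)
pose k : R := (1 / 2) ^+ d / w.
have k0 : 0 <= k by rewrite divr_ge0 ?(ltW w0)// exprn_ge0// divr_ge0.
pose I : R := \int[L]_y `|u y|.
exists (fun xi => k * cos_transform u xi), (fun xi => k * sin_transform u xi), (k * I).
split; [exact: measurable_funM|exact: measurable_funM| |move=> x].
  move=> xi; rewrite !(normrM k) (ger0_norm k0).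
  by split; rewrite ler_wpM2l ?normr_cos_transform_le ?normr_sin_transform_le.
pose G xi := cos (dotrV xi x) * cos_transform u xi +
  sin (dotrV xi x) * sin_transform u xi.
have mG : measurable_fun setT G.
  apply: measurable_funD; apply: measurable_funM => //.
    by apply: measurable_cos_comp; exact: measurable_dotrV.
  by apply: measurable_sin_comp; exact: measurable_dotrV.
have GI xi : `|G xi| <= I + I.
  rewrite (le_trans (ler_normD _ _))// lerD// normrM.
    by rewrite (le_trans _ (normr_cos_transform_le iu xi))// ler_piMl// normr_cos_le1.
  by rewrite (le_trans _ (normr_sin_transform_le iu xi))// ler_piMl// normr_sin_le1.
have G0 xi : ~ cube s xi -> G xi = 0.
  by move=> /u0[c0 s0]; rewrite /G c0 s0 !mulr0 addr0.
(* By [tent_pairing] the two sides are limits of the same sequence. *)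
have E : u x * w = (1 / 2) ^+ d * \int[L]_(xi in cube s) G xi.
  have h1 : \int[L]_y (u y *
        \prod_(i < d) (fejer_mass * tent (harmonic n) (x 0 i - y 0 i)))
      / (harmonic n ^+ 2) ^+ d @[n --> \oo] --> u x * w.
    have /cvg_at_rightP := tent_average iu (cu x); apply.
    by split; [move=> n; rewrite /harmonic/= invr_gt0|exact: cvg_harmonic].
  have h2 := fejer_average mG GI G0.
  apply: cvg_unique h1 _ => //; apply: cvg_trans h2.
  by apply: near_eq_cvg; apply: nearW => n; rewrite tent_pairing.
rewrite (canRL (mulfK (lt0r_neq0 w0)) E).
rewrite mulrAC -/k -RintegralZl//.
- by apply: eq_Rintegral => xi _; rewrite /G mulrDr !(mulrCA k).
- exact: measurable_cube.
- exact: (cube_bounded_integrable s mG GI).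
Qed.

End inversion.

(** * Fourier integrals over a cube *)

Section complex_norm.
Context {R : realType}.
Implicit Types (z : R[i]) (t : R).

Lemma normc_ge0 z : 0 <= normc z.
Proof. by case: z => a b; exact: sqrtr_ge0. Qed.

Lemma normr_Re_le z : `|complex.Re z| <= normc z.
Proof.
by case: z => a b /=; rewrite -sqrtr_sqr ler_sqrt ?addr_ge0 ?sqr_ge0// lerDl sqr_ge0.
Qed.

Lemma normc_real (t : R) : normc t%:C = `|t|.
Proof. by rewrite /= expr0n/= addr0 sqrtr_sqr. Qed.

Lemma normc_imag (t : R) : normc (0 +i* t) = `|t|.
Proof. by rewrite /= expr0n/= add0r sqrtr_sqr. Qed.

Lemma normc_le_Re_Im z : normc z <= `|complex.Re z| + `|complex.Im z|.
Proof.
rewrite [z in leLHS](_ : _ = (complex.Re z)%:C + (0 +i* complex.Im z)).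
  by rewrite (le_trans (le_normcD _ _))// normc_real normc_imag.
by case: z => a b /=; rewrite /GRing.add/= addr0 add0r.
Qed.

Lemma normc_prod (I : Type) (r : seq I) (F : I -> R[i]) :
  normc (\prod_(i <- r) F i) = \prod_(i <- r) normc (F i).
Proof.
by elim/big_rec2: _ => [|i y1 y2 _ <-]; [exact: normc1|rewrite normcM].
Qed.

Lemma normc_sum (I : Type) (r : seq I) (F : I -> R[i]) :
  normc (\sum_(i <- r) F i) <= \sum_(i <- r) normc (F i).
Proof.
elim/big_rec2: _ => [|i y1 y2 _ h]; first by rewrite normc0.
by rewrite (le_trans (le_normcD _ _))// lerD2l.
Qed.

(** Telescoping: one factor is exchanged at a time, those of [F] having modulus 1 and those of [G]
    modulus at most [1 + e]. *)
Lemma normc_prodB (I : Type) (r : seq I) (F G : I -> R[i]) (e : R) : 0 <= e ->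
  (forall i, normc (F i) = 1) -> (forall i, normc (F i - G i) <= e) ->
  normc (\prod_(i <- r) F i - \prod_(i <- r) G i) <= (1 + e) ^+ size r - 1.
Proof.
move=> e0 F1 FG.
have G1 i : normc (G i) <= 1 + e.
  rewrite [G i](_ : _ = F i - (F i - G i)); last by rewrite opprB addrC subrK.
  by rewrite (le_trans (le_normcD _ _))// normcN F1 lerD2l.
have e1 : 0 <= 1 + e by rewrite addr_ge0.
elim: r => [|i r IH]; first by rewrite !big_nil !subrr normc0.
rewrite !big_cons (_ : _ - _ = F i * (\prod_(j <- r) F j - \prod_(j <- r) G j) +
    (F i - G i) * \prod_(j <- r) G j); last by ring.
rewrite (le_trans (le_normcD _ _))// !normcM F1 mul1r.
have GG : normc (\prod_(j <- r) G j) <= (1 + e) ^+ size r.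
  rewrite normc_prod; elim: (r) => [|j s IHs]; first by rewrite big_nil.
  rewrite big_cons exprS; apply: ler_pM => //; first exact: normc_ge0.
  by apply: prodr_ge0 => k _; exact: normc_ge0.
rewrite exprS mulrDl mul1r addrAC lerD//.
by rewrite ler_pM ?normc_ge0.
Qed.

Definition cis t : R[i] := cos t +i* sin t.

Lemma cisD s t : cis (s + t) = cis s * cis t.
Proof. by rewrite /cis cosD sinD /GRing.mul/= (addrC (sin _ * _)). Qed.

Lemma cis0 : cis 0 = 1.
Proof. by rewrite /cis cos0 sin0. Qed.

Lemma normc_cis t : normc (cis t) = 1.
Proof. by rewrite /= cos2Dsin2 sqrtr1. Qed.

Lemma cis_sum (I : Type) (r : seq I) (F : I -> R) :
  cis (\sum_(i <- r) F i) = \prod_(i <- r) cis (F i).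
Proof. exact: (big_morph _ cisD cis0). Qed.

Definition cis_taylor N t : R[i] :=
  \sum_(a < N) 'i%C ^+ a * (t ^+ a / a`!%:R)%:C.

Lemma Re_sum (I : Type) (r : seq I) (F : I -> R[i]) :
  complex.Re (\sum_(i <- r) F i) = \sum_(i <- r) complex.Re (F i).
Proof. by apply: (big_morph (@complex.Re R)) => // -[a b] [x y]. Qed.

Lemma Im_sum (I : Type) (r : seq I) (F : I -> R[i]) :
  complex.Im (\sum_(i <- r) F i) = \sum_(i <- r) complex.Im (F i).
Proof. by apply: (big_morph (@complex.Im R)) => // -[a b] [x y]. Qed.

Lemma normc_cis_taylor N t :
  normc (cis t - cis_taylor N t) <= 2 * (`|t| ^+ N / N`!%:R).
Proof.
rewrite (le_trans (normc_le_Re_Im _))// mulrDl mul1r.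
have [h1 h2] := trig_taylor_bound N t.
have E1 : complex.Re (cis_taylor N t) = cos_taylor N t.
  rewrite Re_sum; apply: eq_bigr => a _; case: ('i%C ^+ a) => x y /=.
  by rewrite mulr0 subr0.
have E2 : complex.Im (cis_taylor N t) = sin_taylor N t.
  rewrite Im_sum; apply: eq_bigr => a _; case: ('i%C ^+ a) => x y /=.
  by rewrite mulr0 add0r.
move: E1 E2; case: (cis_taylor N t) => x y /= -> ->.
exact: lerD.
Qed.

End complex_norm.

Section cube_integral.
Context {R : realType} (d : nat).
Local Notation L := (lebesgue_rV R d).
Local Notation Rd := 'rV[R]_d.
Local Notation cRe := (@complex.Re R).
Local Notation cIm := (@complex.Im R).
Variable s : R.
Implicit Types (h : Rd -> R[i]) (x y xi : Rd).

(** The bound is asked on the cube only, so that polynomials in [xi] are admissible. *)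
Definition admissible h :=
  cmeasurable h /\ exists M, forall xi, cube s xi -> normc (h xi) <= M.

(** Taking the real part keeps the integral real while the integrand is manipulated with complex
    exponentials; a complex function needs two such integrals, see [trig_pair]. *)
Definition cube_integral h : R := \int[L]_(xi in cube s) complex.Re (h xi).

Lemma admissibleD h k : admissible h -> admissible k ->
  admissible (fun xi => h xi + k xi).
Proof.
move=> [[h1 h2] [M hM]] [[k1 k2] [N kN]]; split; last first.
  exists (M + N) => xi cx; rewrite (le_trans (le_normcD _ _))// lerD//.
    exact: hM.
  exact: kN.
split.
  rewrite (_ : _ \o _ = (cRe \o h) \+ (cRe \o k)).
    exact: measurable_funD.
  by apply/funext => xi /=; case: (h xi) (k xi) => ? ? [].
rewrite (_ : _ \o _ = (cIm \o h) \+ (cIm \o k)).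
  exact: measurable_funD.
by apply/funext => xi /=; case: (h xi) (k xi) => ? ? [].
Qed.

Lemma admissibleM h k : admissible h -> admissible k ->
  admissible (fun xi => h xi * k xi).
Proof.
move=> [[h1 h2] [M hM]] [[k1 k2] [N kN]]; split; last first.
  exists (M * N) => xi cx; rewrite normcM; apply: ler_pM; rewrite ?normc_ge0//.
    exact: hM.
  exact: kN.
split.
  rewrite (_ : _ \o _ = ((cRe \o h) \* (cRe \o k)) \-
      ((cIm \o h) \* (cIm \o k))).
    by apply: measurable_funB; exact: measurable_funM.
  by apply/funext => xi /=; case: (h xi) (k xi) => ? ? [].
rewrite (_ : _ \o _ = ((cRe \o h) \* (cIm \o k)) \+
    ((cIm \o h) \* (cRe \o k))).
  by apply: measurable_funD; exact: measurable_funM.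
by apply/funext => xi /=; case: (h xi) (k xi) => ? ? [].
Qed.

Lemma admissible_cst (c : R[i]) : admissible (cst c).
Proof. by split; [split; exact: measurable_cst|exists (normc c)]. Qed.

Lemma admissible_sum (I : Type) (r : seq I) (h : I -> Rd -> R[i]) :
  (forall i, admissible (h i)) -> admissible (fun xi => \sum_(i <- r) h i xi).
Proof.
move=> ah; elim: r => [|i r IH].
  by under eq_fun do rewrite big_nil; exact: admissible_cst.
by under eq_fun do rewrite big_cons; exact: admissibleD.
Qed.

Lemma admissible_prod (I : Type) (r : seq I) (h : I -> Rd -> R[i]) :
  (forall i, admissible (h i)) -> admissible (fun xi => \prod_(i <- r) h i xi).
Proof.
move=> ah; elim: r => [|i r IH].
  by under eq_fun do rewrite big_nil; exact: admissible_cst.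
by under eq_fun do rewrite big_cons; exact: admissibleM.
Qed.

Lemma admissible_pow h n : admissible h -> admissible (fun xi => h xi ^+ n).
Proof.
move=> ah; elim: n => [|n IH].
  by under eq_fun do rewrite expr0; exact: admissible_cst.
by under eq_fun do rewrite exprS; exact: admissibleM.
Qed.

Lemma admissible_coord i : admissible (fun xi => 0 +i* xi 0 i).
Proof.
split; first by split; [exact: measurable_cst|exact: measurable_coord].
by exists s => xi cx; rewrite normc_imag; exact: cx.
Qed.

Lemma admissible_cis x : admissible (fun xi => cis (dotrV xi x)).
Proof.
split; last by exists 1 => xi _; rewrite normc_cis.
split.
  by apply: (measurable_cos_comp (f := fun xi => dotrV xi x)); exact: measurable_dotrV.
by apply: (measurable_sin_comp (f := fun xi => dotrV xi x)); exact: measurable_dotrV.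
Qed.

Lemma admissible_integrable h : admissible h ->
  L.-integrable (cube s) (EFin \o (fun xi => complex.Re (h xi))).
Proof.
move=> [[h1 _] [M hM]]; apply: measurable_bounded_integrable.
- exact: measurable_cube.
- exact: lebesgue_cube_fin.
- exact: measurable_funTS.
- exists M; split; first exact: num_real.
  move=> N MN xi cx /=; rewrite (le_trans (normr_Re_le _))//.
  by rewrite (le_trans (hM _ cx))// ltW.
Qed.

Lemma cube_integralD h k : admissible h -> admissible k ->
  cube_integral (fun xi => h xi + k xi) = cube_integral h + cube_integral k.
Proof.
move=> ah ak; rewrite /cube_integral -RintegralD; first last.
- exact: admissible_integrable.
- exact: admissible_integrable.
- exact: measurable_cube.
by apply: eq_Rintegral => xi _; case: (h xi) (k xi) => ? ? [].
Qed.

Lemma cube_integralZ (c : R) h : admissible h ->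
  cube_integral (fun xi => c%:C * h xi) = c * cube_integral h.
Proof.
move=> ah; rewrite /cube_integral -RintegralZl; last 2 first.
- exact: measurable_cube.
- exact: admissible_integrable.
by apply: eq_Rintegral => xi _; case: (h xi) => a b /=; rewrite mul0r subr0.
Qed.

Lemma cube_integral_sum (I : Type) (r : seq I) (h : I -> Rd -> R[i]) :
  (forall i, admissible (h i)) ->
  cube_integral (fun xi => \sum_(i <- r) h i xi) = \sum_(i <- r) cube_integral (h i).
Proof.
move=> ah; elim: r => [|i r IH].
  rewrite big_nil /cube_integral; under eq_Rintegral do rewrite big_nil.
  by rewrite /= Rintegral_cst ?mul0r//; exact: measurable_cube.
rewrite big_cons -IH -cube_integralD//; last exact: admissible_sum.
by congr cube_integral; apply/funext => xi; rewrite big_cons.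
Qed.

Lemma normr_cube_integral_le h M : admissible h ->
  (forall xi, cube s xi -> normc (h xi) <= M) ->
  `|cube_integral h| <= M * fine (L (cube s)).
Proof.
move=> ah hM; have mC := measurable_cube (d := d) s.
rewrite (le_trans (le_normr_Rintegral mC (admissible_integrable ah)))//.
rewrite -Rintegral_cst//; apply: le_Rintegral => //.
- exact: (integrable_norm (admissible_integrable ah)).
- exact: (cube_bounded_integrable s (G := cst M) (M := `|M|)).
- by move=> xi cx; rewrite (le_trans (normr_Re_le _))// hM.
Qed.

Definition trig_integral h x : R := cube_integral (fun xi => h xi * cis (dotrV xi x)).

Lemma dotrV_shift xi (t : R) i x :
  dotrV xi (t *: delta_mx 0 i + x) = t * xi 0 i + dotrV xi x.
Proof.
rewrite /dotrV (eq_bigr (fun j => xi 0 j * (t * (j == i)%:R) + xi 0 j * x 0 j)).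
  rewrite big_split/=; congr (_ + _).
  rewrite (bigD1 i)//= eqxx mulr1 mulrC big1 ?addr0// => j /negPf ->.
  by rewrite !mulr0.
by move=> j _; rewrite !mxE eqxx /= mulrDr.
Qed.

(** The first-order Taylor remainder of [cis] at [t a] is at most [(t a) ^ 2], then divided by
    [|t|]. *)
Lemma cis_increment (t : R) (a : R) : t != 0 ->
  normc (t^-1%:C * (cis (t * a) - 1) - (0 +i* a)) <= `|t| * a ^+ 2.
Proof.
move=> t0; have E : cis_taylor 2 (t * a) = 1 + t%:C * (0 +i* a).
  rewrite /cis_taylor !big_ord_recr big_ord0/= expr0 expr1 -[0`!]/1%N -[1`!]/1%N !divr1.
  rewrite add0r mul1r; apply/eqP; rewrite eq_complex/=.
  by apply/andP; split; apply/eqP; ring.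
have -> : t^-1%:C * (cis (t * a) - 1) - (0 +i* a) =
    t^-1%:C * (cis (t * a) - cis_taylor 2 (t * a)).
  have tC : t^-1%:C * t%:C = 1 :> R[i] by rewrite -rmorphM/= mulVf.
  by rewrite E opprD addrA [RHS]mulrBr mulrA tC mul1r.
rewrite normcM normc_real normfV ler_pdivrMl ?normr_gt0//.
rewrite (le_trans (normc_cis_taylor _ _))// -[2`!]/2%N normrM exprMn.
by rewrite (real_normK (num_real a)) le_eqVlt; apply/orP; left; apply/eqP; field.
Qed.

(** On the cube the error of the difference quotient of the integrand is at most [M |t| s ^ 2],
    uniformly in [xi], so it can be integrated directly. *)
Lemma derive_trig_integral h i x : admissible h ->
  'D_(delta_mx 0 i) (trig_integral h) x =
  trig_integral (fun xi => (0 +i* xi 0 i) * h xi) x.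
Proof.
move=> ah; apply: cvg_lim => //; have [_ [M hM]] := ah.
apply/cvgrPdist_le => e e0.
pose K := `|M| * s ^+ 2 * fine (L (cube s)).
have K0 : 0 <= K by rewrite mulr_ge0 ?fine_ge0// mulr_ge0 ?sqr_ge0.
near=> t.
have t0 : t != 0 by near: t; exact: nbhs_dnbhs_neq.
have tK : `|t| * K <= e.
  (* The denominator is [K + 1] because [K] may be 0. *)
  have : `|t| <= e / (K + 1).
    by near: t; apply: dnbhs0_le; rewrite divr_gt0// ltr_wpDl.
  rewrite ler_pdivlMr ?ltr_wpDl// => /(le_trans _); apply.
  by rewrite ler_wpM2l// lerDl.
pose B xi := h xi * cis (dotrV xi x).
pose C xi := (0 +i* xi 0 i) * h xi * cis (dotrV xi x).
pose A xi := h xi * cis (dotrV xi (t *: delta_mx 0 i + x)).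
have aB : admissible B by apply: admissibleM => //; exact: admissible_cis.
have aA : admissible A by apply: admissibleM => //; exact: admissible_cis.
have aC : admissible C.
  apply: admissibleM; last exact: admissible_cis.
  by apply: admissibleM => //; exact: admissible_coord.
have aZ c k : admissible k -> admissible (fun xi => c%:C * k xi).
  by move=> ak; apply: admissibleM => //; exact: admissible_cst.
pose G xi := t^-1%:C * (A xi + (-1)%:C * B xi) + (-1)%:C * C xi.
have aAB := admissibleD aA (aZ (-1) _ aB).
have aG : admissible G := admissibleD (aZ t^-1 _ aAB) (aZ (-1) _ aC).
rewrite distrC (_ : _ - _ = cube_integral G).
  apply: le_trans tK; rewrite /K mulrA.
  apply: normr_cube_integral_le => // xi cxi.
  have -> : G xi = h xi * cis (dotrV xi x) *
      (t^-1%:C * (cis (t * xi 0 i) - 1) - (0 +i* xi 0 i)).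
    rewrite /G /A /B /C dotrV_shift cisD !rmorphN/= !rmorph1; ring.
  rewrite normcM normcM normc_cis mulr1 mulrCA.
  rewrite ler_pM ?normc_ge0//; first by rewrite (le_trans (hM _ cxi))// ler_norm.
  rewrite (le_trans (cis_increment _ t0))// ler_wpM2l//.
  by rewrite -(real_normK (num_real (xi 0 i))) lerXn2r ?nnegrE// (le_trans _ (cxi i)).
rewrite /G cube_integralD ?cube_integralZ//; last 2 first.
- exact: aZ.
- exact: aZ.
- rewrite cube_integralD// ?cube_integralZ//; last exact: aZ.
  by rewrite /trig_integral/= /GRing.scale/= !mulN1r.
Unshelve. all: by end_near. Qed.

End cube_integral.

(** * Derivatives and Taylor sums of trigonometric integrals *)

Section trig_taylor_expansion.
Context {R : realType} (d : nat).
Local Notation L := (lebesgue_rV R d).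
Local Notation Rd := 'rV[R]_d.
Variable s : R.
Implicit Types (h : Rd -> R[i]) (x y z xi : Rd).
Local Notation trig := (trig_integral s).
Local Notation adm := (admissible s).

Definition trig_pair h1 h2 x : R[i] := trig h1 x +i* trig h2 x.

Lemma partial_trig_pair i h1 h2 : adm h1 -> adm h2 ->
  partial i (trig_pair h1 h2) =
  trig_pair (fun xi => (0 +i* xi 0 i) * h1 xi) (fun xi => (0 +i* xi 0 i) * h2 xi).
Proof.
move=> a1 a2; apply/funext => x; rewrite /partial /trig_pair.
by rewrite -(derive_trig_integral i x a1) -(derive_trig_integral i x a2).
Qed.

Lemma iter_partial_trig_pair n i h1 h2 : adm h1 -> adm h2 ->
  iter n (partial i) (trig_pair h1 h2) =
  trig_pair (fun xi => (0 +i* xi 0 i) ^+ n * h1 xi)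
    (fun xi => (0 +i* xi 0 i) ^+ n * h2 xi).
Proof.
move=> a1 a2; elim: n => [|n IH] /=.
  by congr trig_pair; apply/funext => xi; rewrite expr0 mul1r.
have aZ h : adm h -> adm (fun xi => (0 +i* xi 0 i) ^+ n * h xi).
  by move=> ah; apply: admissibleM => //; apply: admissible_pow; exact: admissible_coord.
rewrite IH partial_trig_pair; [|exact: aZ|exact: aZ].
by congr trig_pair; apply/funext => xi; rewrite exprS mulrA.
Qed.

(** The Fourier symbol of [D^a]. The index is a plain function, so that multi-indices and points of
    a box of ordinals both fit. *)
Definition imonomial (a : 'I_d -> nat) xi : R[i] :=
  \prod_(i < d) (0 +i* xi 0 i) ^+ a i.

Lemma partials_trig_pair (a : multi_index d) h1 h2 : adm h1 -> adm h2 ->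
  partials a (trig_pair h1 h2) =
  trig_pair (fun xi => imonomial a xi * h1 xi) (fun xi => imonomial a xi * h2 xi).
Proof.
move=> a1 a2; rewrite /partials.
have E : imonomial a = fun xi => \prod_(i <- enum 'I_d) (0 +i* xi 0 i) ^+ a i.
  by apply/funext => xi; rewrite /imonomial big_enum.
rewrite E; elim: (enum 'I_d) => [|i r IH] /=.
  by congr trig_pair; apply/funext => xi; rewrite big_nil mul1r.
have aZ h : adm h -> adm (fun xi => (\prod_(j <- r) (0 +i* xi 0 j) ^+ a j) * h xi).
  move=> ah; apply: admissibleM => //; apply: admissible_prod => j.
  by apply: admissible_pow; exact: admissible_coord.
rewrite IH iter_partial_trig_pair; [|exact: aZ|exact: aZ].
by congr trig_pair; apply/funext => xi; rewrite big_cons mulrA.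
Qed.

Definition taylor_coef z (a : 'I_d -> nat) : R :=
  \prod_(i < d) (z 0 i ^+ a i / (a i)`!%:R).

(** Distributing a product of one-variable sums yields boxes [a_i < N]; this is why the Taylor sums
    run over boxes and not over [|a| < N]. *)
Lemma prod_cis_taylor N z xi :
  \prod_(i < d) cis_taylor N (xi 0 i * z 0 i) =
  \sum_(a : {ffun 'I_d -> 'I_N})
    (taylor_coef z (fun i => a i))%:C * imonomial (fun i => a i) xi.
Proof.
rewrite bigA_distr_bigA/=; apply: eq_bigr => a _.
rewrite /taylor_coef rmorph_prod /imonomial -big_split/=; apply: eq_bigr => i _.
have -> : 0 +i* xi 0 i = 'i%C * (xi 0 i)%:C :> R[i].
  by apply/eqP; rewrite eq_complex/=; apply/andP; split; apply/eqP; ring.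
rewrite !exprMn !rmorphM/= !rmorphXn/=; ring.
Qed.

(** The box sum is the integral in which each factor [cis (xi_i z_i)] is replaced by its Taylor
    polynomial, so the remainder is a difference of products, small uniformly on the cube. *)
Lemma trig_integral_taylor h y z (e : R) : adm h -> 0 < e ->
  \forall N \near \oo, `|trig h (y + z) - \sum_(a : {ffun 'I_d -> 'I_N})
    taylor_coef z (fun i => a i) *
    trig (fun xi => imonomial (fun i => a i) xi * h xi) y| <= e.
Proof.
move=> ah e0; have [_ [M hM]] := ah.
(* [T] bounds every [|xi_i z_i|] on the cube, hence [eps N] bounds each one-variable remainder. *)
pose T := `|s| * \sum_(i < d) `|z 0 i|.
pose eps N := 2 * exp_coeff T N.
pose K := `|M| * fine (L (cube s)).
have : (((1 + eps N) ^+ d - 1) * K) @[N --> \oo] --> (((1 + 2 * 0) ^+ d - 1) * K).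
  apply: cvgMr_tmp; apply: cvgB; last exact: cvg_cst.
  apply: (@continuous_cvg _ _ _ _ _ (fun N => 1 + eps N) (fun x : R => x ^+ d)).
    exact: exprn_continuous.
  apply: cvgD; first exact: cvg_cst.
  by apply: cvgMl_tmp; exact: cvg_exp_coeff.
rewrite mulr0 addr0 expr1n subrr mul0r => /cvgrPdist_le/(_ _ e0).
apply: filterS => N; rewrite sub0r normrN => /(le_trans (ler_norm _)).
apply: le_trans.
have am a : adm (imonomial a).
  by apply: admissible_prod => i; apply: admissible_pow; exact: admissible_coord.
pose G xi := (\prod_(i < d) cis (xi 0 i * z 0 i) -
  \prod_(i < d) cis_taylor N (xi 0 i * z 0 i)) * (h xi * cis (dotrV xi y)).
have T0 : 0 <= T by rewrite mulr_ge0// sumr_ge0.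
have eN0 : 0 <= eps N by rewrite mulr_ge0// exp_coeff_ge0.
have ahc : adm (fun xi => h xi * cis (dotrV xi y)).
  by apply: admissibleM => //; exact: admissible_cis.
have aT (a : {ffun 'I_d -> 'I_N}) : adm (fun xi =>
    (taylor_coef z (fun i => a i))%:C *
    (imonomial (fun i => a i) xi * h xi * cis (dotrV xi y))).
  apply: admissibleM; first exact: admissible_cst.
  apply: admissibleM; last exact: admissible_cis.
  exact: admissibleM.
have aS : adm (fun xi => \prod_(i < d) cis_taylor N (xi 0 i * z 0 i) *
    (h xi * cis (dotrV xi y))).
  have := admissible_sum (index_enum {ffun 'I_d -> 'I_N}) aT.
  congr admissible; apply/funext => xi; rewrite prod_cis_taylor mulr_suml.
  by apply: eq_bigr => a _; rewrite !mulrA.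
have acz : adm (fun xi => \prod_(i < d) cis (xi 0 i * z 0 i) *
    (h xi * cis (dotrV xi y))).
  have := admissibleM (admissible_cis s z) ahc.
  by congr admissible; apply/funext => xi; rewrite /dotrV cis_sum.
have aG : adm G.
  have := admissibleD acz (admissibleM (admissible_cst d s (-1)) aS).
  by congr admissible; apply/funext => xi; rewrite /G /= mulN1r mulrBl.
rewrite (_ : _ - _ = cube_integral s G).
  rewrite mulrA; apply: normr_cube_integral_le => // xi cxi.
  rewrite normcM ler_pM ?normc_ge0//; last first.
    by rewrite normcM normc_cis mulr1 (le_trans (hM _ cxi))// ler_norm.
  rewrite (le_trans (normc_prodB _ (e := eps N) _ _ _))//.
  - by move=> i; exact: normc_cis.
  - move=> i; rewrite (le_trans (normc_cis_taylor _ _))// /eps ler_pM2l// /exp_coeff.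
    rewrite ler_pM2r ?invr_gt0 ?ltr0n ?fact_gt0// lerXn2r ?nnegrE// normrM.
    rewrite ler_pM// ?(le_trans (cxi i)) ?ler_norm//.
    by rewrite (bigD1 i)//= lerDl sumr_ge0.
  - by rewrite /index_enum -enumT size_enum_ord.
have -> : \sum_(a : {ffun 'I_d -> 'I_N}) taylor_coef z (fun i => a i) *
    trig (fun xi => imonomial (fun i => a i) xi * h xi) y =
    cube_integral s (fun xi => \prod_(i < d) cis_taylor N (xi 0 i * z 0 i) *
    (h xi * cis (dotrV xi y))).
  transitivity (cube_integral s (fun xi => \sum_(a : {ffun 'I_d -> 'I_N})
    (taylor_coef z (fun i => a i))%:C *
    (imonomial (fun i => a i) xi * h xi * cis (dotrV xi y)))).
    rewrite cube_integral_sum//; apply: eq_bigr => a _.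
    rewrite cube_integralZ//; apply: admissibleM; last exact: admissible_cis.
    exact: admissibleM.
  congr cube_integral; apply/funext => xi; rewrite prod_cis_taylor mulr_suml.
  by apply: eq_bigr => a _; rewrite !mulrA.
rewrite /trig_integral -mulN1r -cube_integralZ// -cube_integralD//; last 2 first.
- by apply: admissibleM => //; exact: admissible_cis.
- by apply: admissibleM => //; exact: admissible_cst.
congr cube_integral; apply/funext => xi.
rewrite /G mulrBl rmorphN1 mulN1r; congr (_ - _).
have -> : dotrV xi (y + z) = dotrV xi z + dotrV xi y.
  by rewrite /dotrV -big_split/=; apply: eq_bigr => i _; rewrite mxE mulrDr addrC.
by rewrite cisD mulrCA {1}/dotrV cis_sum.
Qed.

End trig_taylor_expansion.

(** * Taylor expansion of band-limited functions *)

Section band_limited_expansion.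
Context {R : realType} (d : nat).
Local Notation L := (lebesgue_rV R d).
Local Notation Rd := 'rV[R]_d.
Local Notation cRe := (@complex.Re R).
Local Notation cIm := (@complex.Im R).
Implicit Types (g : Rd -> R[i]) (x y z xi : Rd).

Lemma fourierE g xi : L1 g -> fourier g xi =
  (cos_transform (cRe \o g) xi + sin_transform (cIm \o g) xi) +i*
  (cos_transform (cIm \o g) xi - sin_transform (cRe \o g) xi).
Proof.
move=> [g1 g2]; rewrite /fourier /cintegral /cos_transform /sin_transform.
rewrite -RintegralD//; [|exact: integrable_mul_cos|exact: integrable_mul_sin].
rewrite -RintegralB//; [|exact: integrable_mul_cos|exact: integrable_mul_sin].
congr (_ +i* _); apply: eq_Rintegral => y _; rewrite /expNi/=;
  case: (g y) => a b /=; ring.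
Qed.

Lemma cubeN s xi : cube s xi -> cube s (- xi).
Proof. by move=> h i; rewrite mxE normrN. Qed.

Lemma dotrVN xi y : dotrV (- xi) y = - dotrV xi y.
Proof. by rewrite /dotrV -sumrN; apply: eq_bigr => i _; rewrite mxE mulNr. Qed.

Lemma cos_transformN (u : Rd -> R) xi : cos_transform u (- xi) = cos_transform u xi.
Proof. by apply: eq_Rintegral => y _; rewrite dotrVN cosN. Qed.

Lemma sin_transformN (u : Rd -> R) xi : L.-integrable setT (EFin \o u) ->
  sin_transform u (- xi) = - sin_transform u xi.
Proof.
move=> iu; rewrite /sin_transform -mulN1r -RintegralZl//; last exact: integrable_mul_sin.
by apply: eq_Rintegral => y _; rewrite dotrVN sinN mulrN mulN1r.
Qed.

(* The cube is symmetric, so the transform vanishes at [xi] and at [- xi], which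
   separates the four real transforms. *)
Lemma band_limited_transform0 X s g : band_limited X s g ->
  forall xi, ~ cube s xi ->
  [/\ cos_transform (cRe \o g) xi = 0, sin_transform (cRe \o g) xi = 0,
    cos_transform (cIm \o g) xi = 0 & sin_transform (cIm \o g) xi = 0].
Proof.
move=> [_ L1g _ suppg] xi ncxi; have [g1 g2] := L1g.
have F0 z : ~ cube s z -> fourier g z = 0.
  move=> ncz; apply/eqP/negPn/negP => Fz; apply: ncz; apply: suppg.
  exact: subset_closure.
have := F0 _ ncxi; have := F0 (- xi); rewrite !fourierE// !cos_transformN.
rewrite !sin_transformN// => h [h3 h4]; 
have ncN : ~ cube s (- xi).
  by move=> cxi; apply: ncxi; rewrite -[xi]opprK; exact: cubeN.
have [h1 h2] := h ncN.
by split; lra.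
Qed.

Lemma band_limited_trig_pair X s g : band_limited X s g ->
  exists h1 h2, [/\ admissible s h1, admissible s h2 & g = trig_pair s h1 h2].
Proof.
move=> bg; have g0 := band_limited_transform0 bg; have [_ [g1 g2] [c1 c2] _] := bg.
have repr (u : Rd -> R) : L.-integrable setT (EFin \o u) -> continuous u ->
    (forall xi, ~ cube s xi -> cos_transform u xi = 0 /\ sin_transform u xi = 0) ->
    exists2 h, admissible s h & forall x, u x = trig_integral s h x.
  move=> iu cu u0; have [U [V [M [mU mV UV E]]]] := band_limited_inversion iu cu u0.
  (* The real part of [(U - i V) * cis t] is [U cos t + V sin t]. *)
  exists (fun xi => U xi -i* V xi).
    split; first by split => //; exact: measurable_funN.
    exists (M + M) => xi _; rewrite (le_trans (normc_le_Re_Im _))//= normrN.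
    by have [] := UV xi; exact: lerD.
  move=> x; rewrite E; apply: eq_Rintegral => xi _ /=.
  by rewrite mulNr opprK mulrC (mulrC (sin _)).
have [|h1 a1 E1] := repr _ g1 c1; first by move=> xi /g0[].
have [|h2 a2 E2] := repr _ g2 c2; first by move=> xi /g0[].
exists h1, h2; split => //; apply/funext => x; rewrite /trig_pair -E1 -E2 /=.
by case: (g x).
Qed.

Definition box_index N (a : {ffun 'I_d -> 'I_N}) : multi_index d :=
  [ffun i => a i : nat].

Lemma band_limited_taylor X s g y z (e : R) : band_limited X s g -> 0 < e ->
  \forall N \near \oo, normc (g (y + z) - \sum_(a : {ffun 'I_d -> 'I_N})
    (taylor_coef z (box_index a))%:C * partials (box_index a) g y) <= e.
Proof.
move=> /band_limited_trig_pair[h1 [h2 [a1 a2 ->]]] e0.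
have e2 : 0 < e / 2 by rewrite divr_gt0.
have T1 := trig_integral_taylor y z a1 e2; have T2 := trig_integral_taylor y z a2 e2.
near=> N.
have : `|trig_integral s h1 (y + z) - \sum_(a : {ffun 'I_d -> 'I_N})
    taylor_coef z (fun i => a i) *
    trig_integral s (fun xi => imonomial (fun i => a i) xi * h1 xi) y| <= e / 2.
  by near: N.
have : `|trig_integral s h2 (y + z) - \sum_(a : {ffun 'I_d -> 'I_N})
    taylor_coef z (fun i => a i) *
    trig_integral s (fun xi => imonomial (fun i => a i) xi * h2 xi) y| <= e / 2.
  by near: N.
set S2 := (\sum_(a : _) _); set S1 := (\sum_(a : _) _) => B2 B1.
rewrite (_ : \sum_(a : _) _ = S1 +i* S2).
  by rewrite (le_trans (normc_le_Re_Im _))//= (le_trans (lerD B1 B2))// -splitr.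
have boxE (a : {ffun 'I_d -> 'I_N}) : (box_index a : 'I_d -> nat) = (fun i => a i).
  by apply/funext => i; rewrite ffunE.
apply/eqP; rewrite eq_complex Re_sum Im_sum/=; apply/andP; split; apply/eqP;
  apply: eq_bigr => a _; rewrite partials_trig_pair// boxE;
  by rewrite /trig_pair/=; ring.
Unshelve. all: by end_near. Qed.

End band_limited_expansion.

(** * Enumeration of nonzero multi-indices and bounds on increments *)

Section multi_index_enumeration.
Context {R : realType} (d : nat).
Local Notation Rd := 'rV[R]_d.

Lemma ler_sum_uniq_subset (I : eqType) (s t : seq I) (F : I -> R) :
  uniq s -> uniq t -> {subset s <= t} -> (forall i, 0 <= F i) ->
  \sum_(i <- s) F i <= \sum_(i <- t) F i.
Proof.
move=> us ut st F0; rewrite [leRHS](bigID (mem s))/= -[leLHS]addr0 lerD ?sumr_ge0//.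
rewrite -[leRHS]big_filter le_eqVlt; apply/orP; left; apply/eqP; apply: perm_big.
apply: uniq_perm => //; first exact: filter_uniq.
by move=> i; rewrite mem_filter; apply/idP/andP => [h|[]//]; split => //; exact: st.
Qed.

Definition mi0 : multi_index d := [ffun=> 0%N].

(* [pickle_inv] rather than [unpickle], so that no index is listed twice. *)
Definition nonzero_mi n : option (multi_index d) :=
  if pickle_inv n is Some a then (if a == mi0 then None else Some a) else None.

Definition nonzero_mi_upto K : seq (multi_index d) := pmap nonzero_mi (iota 0 K).

Lemma nonzero_mi_upto_uniq K : uniq (nonzero_mi_upto K).
Proof.
apply: (@pmap_uniq _ _ nonzero_mi pickle); last exact: iota_uniq.
move=> n; rewrite /nonzero_mi.
case E : (pickle_inv n) => [a|]//; case: eqP => //= _.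
by have := @pickle_invK (multi_index d) n; rewrite E.
Qed.

Lemma mem_nonzero_mi_upto K a :
  a != mi0 -> (pickle a < K)%N -> a \in nonzero_mi_upto K.
Proof.
move=> a0 aK; rewrite mem_pmap; apply/mapP; exists (pickle a).
  by rewrite mem_iota.
by rewrite /nonzero_mi pickleK_inv (negPf a0).
Qed.

Lemma nonzero_mi_upto_neq0 K a : a \in nonzero_mi_upto K -> a != mi0.
Proof.
rewrite mem_pmap => /mapP[n _]; rewrite /nonzero_mi.
by case: pickle_inv => // b; case: eqP => // /eqP b0 [->].
Qed.

Lemma nonzero_mi_upto_sub (s : seq (multi_index d)) :
  (forall a, a \in s -> a != mi0) ->
  exists K, {subset s <= nonzero_mi_upto K}.
Proof.
move=> s0; exists (\max_(a <- s) pickle a).+1 => a sa.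
by apply: mem_nonzero_mi_upto; [exact: s0|rewrite ltnS; exact: leq_bigmax_seq].
Qed.

Definition taylor_weight (r : R) (a : multi_index d) : R :=
  r ^+ mi_abs a / (mi_fact a)%:R.

Lemma taylor_weight_ge0 r a : 0 <= r -> 0 <= taylor_weight r a.
Proof. by move=> r0; rewrite divr_ge0 ?exprn_ge0. Qed.

Lemma normr_taylor_coef_le r (z : Rd) (a : multi_index d) :
  (forall i, `|z 0 i| <= r) -> `|taylor_coef z a| <= taylor_weight r a.
Proof.
move=> zr; rewrite /taylor_coef /taylor_weight normr_prod /mi_abs /mi_fact.
rewrite -prodrXr natr_prod -prodfV -big_split/=; apply: ler_prod => i _.
rewrite normr_ge0/= normrM normfV normrX normr_nat.
rewrite ler_pM2r ?invr_gt0 ?ltr0n ?fact_gt0// lerXn2r// ?nnegrE//.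
by rewrite (le_trans _ (zr i)).
Qed.

Lemma box_index_inj N : injective (@box_index d N).
Proof.
move=> a b /ffunP ab; apply/ffunP => i; have := ab i; rewrite !ffunE => h.
exact: val_inj.
Qed.

Lemma box_index_ord0 N : box_index [ffun=> ord0 : 'I_N.+1] = mi0.
Proof. by apply/ffunP => i; rewrite !ffunE. Qed.

Lemma partials0 (g : Rd -> R[i]) : partials mi0 g = g.
Proof.
by rewrite /partials; elim: (enum 'I_d) => //= i s ->; rewrite ffunE.
Qed.

Lemma taylor_coef0 (z : Rd) : taylor_coef z mi0 = 1.
Proof.
by rewrite /taylor_coef big1// => i _; rewrite ffunE expr0 fact0 divr1.
Qed.

(** The box sums approximate [g x], and the nonzero indices of a box all occur in some prefix of the
    enumeration, so a bound on all prefixes suffices. Only derivatives at [y] appear, while [x] is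
    free. *)
Lemma taylor_increment_le X s (g : Rd -> R[i]) (x y : Rd) (r c : R) :
  0 <= r -> band_limited X s g ->
  (forall i, `|x 0 i - y 0 i| <= r) ->
  (forall K, \sum_(a <- nonzero_mi_upto K)
    taylor_weight r a * normc (partials a g y) <= c) ->
  normc (g x - g y) <= c.
Proof.
move=> r0 bg xyr hc; apply/ler_addgt0Pr => e e0.
(* The successor guarantees that the box contains the zero index, whose term is [g y]. *)
have [N0 _ /(_ N0.+1 (leqnSn _))] := band_limited_taylor y (x - y) bg e0.
rewrite (addrC y) subrK (bigD1 [ffun=> ord0])//= box_index_ord0 taylor_coef0 partials0.
rewrite mul1r; set S := (X in g y + X) => hS.
rewrite (_ : g x - g y = (g x - (g y + S)) + S); last by ring.
rewrite (le_trans (le_normcD _ _))// addrC lerD//.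
pose t := [seq box_index a | a <- enum {ffun 'I_d -> 'I_N0.+1} & a != [ffun=> ord0]].
have [K tK] : exists K, {subset t <= nonzero_mi_upto K}.
  apply: nonzero_mi_upto_sub => _ /mapP[a + ->]; rewrite mem_filter => /andP[a0 _].
  by apply: contra a0 => /eqP; rewrite -(box_index_ord0 N0) => /box_index_inj ->.
apply: le_trans (hc K).
have xr i : `|(x - y) 0 i| <= r by rewrite !mxE.
pose f a := taylor_weight r a * normc (partials a g y).
apply: (@le_trans _ _ (\sum_(b <- t) f b)); last first.
  apply: ler_sum_uniq_subset => //; last 2 first.
  - exact: nonzero_mi_upto_uniq.
  - by move=> a; rewrite mulr_ge0 ?normc_ge0// taylor_weight_ge0.
  rewrite map_inj_uniq; last exact: box_index_inj.
  by rewrite filter_uniq// enum_uniq.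
rewrite big_map big_filter big_enum_cond/=.
rewrite /S -!(big_filter _ (fun a => a != _)) (le_trans (normc_sum _ _))//.
apply: ler_sum => a _; rewrite normcM normc_real ler_wpM2r ?normc_ge0//.
exact: normr_taylor_coef_le.
Qed.

End multi_index_enumeration.

(** * Series in a quasi-Banach lattice *)

Section lattice_series.
Context {R : realType} (d : nat).
Local Notation Rd := 'rV[R]_d.
Variables (mu : {measure set Rd -> \bar R}) (q : R).
Variables (X : set (Rd -> R[i])) (N : (Rd -> R[i]) -> R).
Hypotheses (hq : 0 < q) (hX : quasi_banach_lattice mu q X N).
Implicit Types f g : Rd -> R[i].

Lemma lattice_sub f g : X f -> X g -> X (f \- g).
Proof.
move=> Xf Xg; have := qbl_add hX Xf (qbl_scale hX (-1) Xg).
by congr X; apply/funext => x /=; rewrite mulN1r.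
Qed.

Lemma lattice_normB f g : X f -> X g -> N (f \- g) = N (g \- f).
Proof.
move=> Xf Xg; rewrite (_ : f \- g = fun x => -1 * (g \- f) x).
  by rewrite (qbl_normZ hX)// ?normcN ?normc1 ?mul1r//; exact: lattice_sub.
by apply/funext => x /=; rewrite mulN1r opprB.
Qed.

Lemma lattice_norm_le f g : X f -> X g -> (forall x, normc (f x) <= normc (g x)) ->
  N f <= N g.
Proof. by move=> Xf Xg fg; apply: (qbl_le hX) => //; exact: aeW. Qed.

Lemma lattice_norm0 f : X f -> (forall e, 0 < e -> N f <= e) ->
  {ae mu, forall x, f x = 0}.
Proof.
move=> Xf Ne; apply/(qbl_eq0 hX Xf)/eqP; rewrite eq_le (qbl_ge0 hX)// andbT.
by apply/ler_addgt0Pl => e e0; rewrite addr0 Ne.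
Qed.

Lemma lattice_zero f : X f -> X (fun=> 0).
Proof.
by move=> Xf; have := qbl_scale hX 0 Xf; congr X; apply/funext => x; rewrite mul0r.
Qed.

Lemma lattice_norm_zero f : X f -> N (fun=> 0) = 0.
Proof. by move=> Xf; apply/(qbl_eq0 hX (lattice_zero Xf)); exact: aeW. Qed.

Lemma lattice_normc f : X f -> N (fun x => (normc (f x))%:C) = N f.
Proof.
move=> Xf; have Xa := qbl_abs hX Xf; apply/eqP; rewrite eq_le.
by rewrite !lattice_norm_le// => x; rewrite normc_real ger0_norm// normc_ge0.
Qed.

Lemma powR_lt_inv (a e : R) : 0 <= a -> 0 < e -> a `^ q < e `^ q -> a < e.
Proof.
move=> a0 e0; apply: contraTT; rewrite -!leNgt => ea.
by apply: ge0_ler_powR; rewrite ?nnegrE ?(ltW hq) ?(ltW e0).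
Qed.

Lemma powR_le_inv (a e : R) : 0 <= a -> 0 <= e -> a `^ q <= e `^ q -> a <= e.
Proof.
move=> a0 e0; apply: contraTT; rewrite -!ltNge => ea.
by apply: gt0_ltr_powR; rewrite ?nnegrE.
Qed.

Lemma lattice_sum_segment (phi : nat -> Rd -> R[i]) : (forall n, X (phi n)) ->
  forall m k, X (fun x => \sum_(m <= i < m + k) phi i x) /\
  N (fun x => \sum_(m <= i < m + k) phi i x) `^ q <= \sum_(m <= i < m + k) N (phi i) `^ q.
Proof.
move=> Xphi m; elim=> [|k [IH1 IH2]].
  rewrite addn0 big_geq//; under eq_fun do rewrite big_geq//.
  rewrite (lattice_norm_zero (Xphi 0%N)) powR0 ?gt_eqF//; split => //.
  exact: lattice_zero (Xphi 0%N).
rewrite addnS big_nat_recr ?leq_addr//=.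
under eq_fun do rewrite big_nat_recr ?leq_addr//=.
split; first exact: (qbl_add hX IH1 (Xphi _)).
by rewrite (le_trans (qbl_triangle hX IH1 (Xphi _)))// lerD2r.
Qed.

(* [f] is the modulus of the limit of the partial sums; it dominates each of
   them almost everywhere because the positive part of the difference has
   arbitrarily small norm. *)
Lemma lattice_series_majorant (rho : nat -> Rd -> R) (c : R) :
  (forall n x, 0 <= rho n x) -> (forall n, X (fun x => (rho n x)%:C)) ->
  (forall K, \sum_(0 <= n < K) N (fun x => (rho n x)%:C) `^ q <= c) ->
  exists f : Rd -> R, [/\ forall x, 0 <= f x, X (fun x => (f x)%:C),
    N (fun x => (f x)%:C) `^ q <= c &
    {ae mu, forall x, forall K, \sum_(0 <= n < K) rho n x <= f x}].
Proof.
move=> rho0 Xrho Nc.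
pose phi n x : R[i] := (rho n x)%:C.
pose S n x : R[i] := \sum_(0 <= i < n) phi i x.
have seg := lattice_sum_segment Xrho.
have XS n : X (S n) by have [] := seg 0%N n; rewrite add0n.
have NS n : N (S n) `^ q <= \sum_(0 <= i < n) N (phi i) `^ q.
  by have [] := seg 0%N n; rewrite add0n.
pose T n := \sum_(0 <= i < n) N (phi i) `^ q.
have ndT : nondecreasing_seq T.
  apply/nondecreasing_seqP => n; rewrite /T big_nat_recr//= lerDl.
  exact: powR_ge0.
have cT : cvgn T.
  apply: nondecreasing_is_cvgn => //; exists c => _ [n _ <-]; exact: Nc.
have segT m n : (m <= n)%N -> N (S n \- S m) `^ q <= T n - T m.
  move=> mn; rewrite /T (big_cat_nat (n := m))//= addrAC subrr add0r.
  have [_] := seg m (n - m)%N; rewrite subnKC//.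
  congr (N _ `^ q <= _); apply/funext => x.
  by rewrite /S/= (@big_cat_nat _ _ _ m 0 n)//= addrAC subrr add0r.
(* By [segT] the [q]-th powers of the norms of differences are bounded by differences of the
   convergent [T], so [S] is Cauchy. *)
have [e e0|F XF NF] := qbl_complete hX XS.
  have eq0 : 0 < e `^ q by rewrite powR_gt0.
  have /cvgrPdist_lt/(_ _ eq0)[n0 _ hn0] := cT.
  have ndl n : T n <= limn T := nondecreasing_cvgn_le ndT cT n.
  have main m n : (n0 <= m)%N -> (m <= n)%N -> N (S n \- S m) < e.
    move=> m0 mn; apply: powR_lt_inv => //.
      by apply: (qbl_ge0 hX); exact: lattice_sub.
    apply: le_lt_trans (segT _ _ mn) _; apply: le_lt_trans (hn0 _ m0).
    by rewrite (le_trans _ (ler_norm _))// lerD2r.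
  exists n0 => m n m0 n1; have [mn|nm] := leqP m n; last exact: main (ltnW nm).
  by rewrite lattice_normB//; exact: main.
have small e : 0 < e -> exists n0, forall n, (n0 <= n)%N -> N (S n \- F) <= e.
  move=> e0; have /cvgrPdist_le/(_ _ e0)[n0 _ h] := NF; exists n0 => n n0n.
  have := h _ n0n; rewrite sub0r normrN ger0_norm//.
  by apply: (qbl_ge0 hX); exact: lattice_sub.
pose f x := normc (F x).
have Xf : X (fun x => (f x)%:C) := qbl_abs hX XF.
exists f; split => // [x| |]; first exact: normc_ge0.
  rewrite lattice_normc//; apply/ler_addgt0Pr => e e0.
  (* The root is taken so that the [q]-th power of the error norm is at most [e]. *)
  have [|n0 h] := small (e `^ q^-1); first exact: powR_gt0.
  have -> : F = (S n0) \+ (F \- S n0) by apply/funext => x /=; rewrite addrC subrK.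
  rewrite (le_trans (qbl_triangle hX (XS _) (lattice_sub XF (XS _))))//.
  rewrite lerD ?(le_trans (NS _))// lattice_normB//.
  have := h _ (leqnn n0); move/(ge0_ler_powR (ltW hq)) => /(_ _ _)/le_trans; apply.
  - by rewrite nnegrE (qbl_ge0 hX)//; exact: lattice_sub.
  - by rewrite nnegrE powR_ge0.
  - by rewrite -powRrM mulVf ?gt_eqF// powRr1// ltW.
apply: ae_foralln => K.
pose D x := \sum_(0 <= n < K) rho n x - f x.
have SE n x : S n x = (\sum_(0 <= i < n) rho i x)%:C by rewrite rmorph_sum.
have XD : X (fun x => (D x)%:C).
  have := lattice_sub (XS K) Xf; congr X; apply/funext => x /=.
  by rewrite SE -rmorphB.
(* The positive part of [D], written with the operations under which [X] is closed. *)
have XDp : X (fun x => ((D x + `|D x|) / 2)%:C).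
  have := qbl_scale hX (2^-1)%:C (qbl_add hX XD (qbl_abs hX XD)).
  congr X; apply/funext => x /=.
  by rewrite expr0n/= addr0 sqrtr_sqr -!rmorphD -rmorphM/= mulrC.
have D0 : {ae mu, forall x, ((D x + `|D x|) / 2)%:C = 0 :> R[i]}.
  apply: lattice_norm0 => // e e0; have [n0 h] := small e e0.
  (* The partial sums increase, so for [n >= K] one has [D <= S n - |F| <= |S n - F|], and this norm
     is small. *)
  apply: le_trans (h _ (leq_maxr K n0)).
  apply: lattice_norm_le => //; first exact: lattice_sub.
  move=> x; rewrite normc_real.
  have n_ge0 := normc_ge0 (S (maxn K n0) x - F x).
  suff Dn : D x <= normc (S (maxn K n0) x - F x).
    by have [D0|D0] := leP 0 (D x); [rewrite (ger0_norm D0)|rewrite (ltr0_norm D0)];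
      rewrite ger0_norm; lra.
  have : normc (S (maxn K n0) x) <= normc (S (maxn K n0) x - F x) + f x.
    by rewrite -[X in normc X <= _](subrK (F x)) le_normcD.
  rewrite [X in normc X <= _]SE normc_real ger0_norm ?sumr_ge0//.
  rewrite -lerBlDr; apply: le_trans; rewrite lerD2r.
  by rewrite (@big_cat_nat _ _ _ K 0 (maxn K n0)) ?leq_maxl//= lerDl sumr_ge0.
apply: filterS D0 => x [] /eqP.
rewrite mulf_eq0 invr_eq0 pnatr_eq0 orbF => /eqP Dx.
by move: Dx; rewrite -subr_le0 -/(D x); have := ler_norm (D x); lra.
Qed.

End lattice_series.

(** * Lattice cells *)

Section lattice_cells.
Context {R : realType} (d : nat).
Local Notation Rd := 'rV[R]_d.
Local Notation index := {ffun 'I_d -> int}.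
Variables (W : R) (W0 : 0 < W).
Implicit Types (y : Rd) (c : index -> R).

(** Cell [k] has [k / W] as its upper corner: a cell containing [y] has [k_i] equal to
    [floor (W y_i) + 1], or to [floor (W y_i)] when [W y_i] is an integer. These are the [2 ^ d]
    candidates. *)
Definition near_cell y (b : {ffun 'I_d -> bool}) : index :=
  [ffun i => Num.floor (W * y 0 i) + (b i : nat)%:Z].

Lemma near_cell_inj y : injective (near_cell y).
Proof.
move=> b b' /ffunP bb; apply/ffunP => i; have := bb i; rewrite !ffunE.
by move=> /addrI; case: (b i) (b' i) => -[].
Qed.

Lemma lattice_cellE y (k : index) : lattice_cell W k y <->
  forall i, (k i)%:~R - 1 <= W * y 0 i <= (k i)%:~R.
Proof.
by split=> h i; have := h i; rewrite ler_pdivrMr// ler_pdivlMr// mulrC.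
Qed.

Lemma lattice_cell_near y (k : index) :
  lattice_cell W k y -> exists b, k = near_cell y b.
Proof.
move=> /lattice_cellE ky; exists [ffun i => k i != Num.floor (W * y 0 i)].
apply/ffunP => i; rewrite !ffunE; have /andP[k1 k2] := ky i.
have /andP[f1 f2] := floor_itv (W * y 0 i).
case: eqVneq => [|kf]; first by rewrite addr0.
have fk : Num.floor (W * y 0 i) <= k i.
  by rewrite -(ler_int R) (le_trans f1).
have kf2 : k i < Num.floor (W * y 0 i) + 2.
  by rewrite -(ltr_int R) intrD; move: f2; rewrite intrD; lra.
apply/eqP; rewrite eq_le; apply/andP; split; first by rewrite -ltzD1 -addrA.
by rewrite lezD1 lt_neqAle eq_sym kf.
Qed.

Lemma near_cell_true y : lattice_cell W (near_cell y [ffun=> true]) y.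
Proof.
apply/lattice_cellE => i; rewrite !ffunE intrD addrK.
by have /andP[-> /ltW] := floor_itv (W * y 0 i); rewrite intrD.
Qed.

Lemma lattice_cell_dist y y' (k : index) i :
  lattice_cell W k y -> lattice_cell W k y' ->
  `|y 0 i - y' 0 i| <= W^-1.
Proof.
move=> /(_ i) + /(_ i); rewrite mulrBl mul1r => /andP[h1 h2] /andP[h3 h4].
by rewrite ler_norml; apply/andP; split; lra.
Qed.

Lemma measurable_lattice_cell (k : index) : measurable (lattice_cell W k : set Rd).
Proof.
rewrite (_ : lattice_cell W k = \bigcap_(i in [set: 'I_d])
    ((fun v : Rd => v 0 i : measurableTypeR R) @^-1`
      `[((k i)%:~R - 1) / W, (k i)%:~R / W]%classic)).
  apply: fin_bigcap_measurable => // i _; rewrite -[X in measurable X]setTI.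
  exact: measurable_coord.
by apply/seteqP; split => v /= h i; [move=> _; exact: h|exact: h].
Qed.

Lemma cell_sumE c y (r : seq index) : uniq r -> (forall b, near_cell y b \in r) ->
  \sum_(k \in [set: index]) c k * \1_(lattice_cell W k) y =
  \sum_(k <- r) c k * \1_(lattice_cell W k) y.
Proof.
move=> ur ry; rewrite (fsbigE _ _ ur)//.
  by apply: eq_bigl => k; rewrite in_setT.
move=> k _ kr; rewrite indicE memNset ?mulr0// => /lattice_cell_near[b kb].
by move: kr; rewrite kb ry.
Qed.

Lemma cell_sum_near c y :
  \sum_(k \in [set: index]) c k * \1_(lattice_cell W k) y =
  \sum_(b : {ffun 'I_d -> bool})
    c (near_cell y b) * \1_(lattice_cell W (near_cell y b)) y.
Proof.
rewrite (@cell_sumE c y [seq near_cell y b | b <- enum {ffun 'I_d -> bool}]).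
- by rewrite big_map big_enum.
- by rewrite map_inj_uniq ?enum_uniq//; exact: near_cell_inj.
- by move=> b; rewrite map_f// mem_enum.
Qed.

(** The sum over all cells is a pointwise limit of sums over prefixes of the pickling enumeration,
    which at each [y] are eventually constant. *)
Lemma measurable_cell_sum c : measurable_fun setT
  (fun y : Rd => \sum_(k \in [set: index]) c k * \1_(lattice_cell W k) y).
Proof.
pose r K : seq index := pmap pickle_inv (iota 0 K).
have ur K : uniq (r K) by apply: (pmap_uniq (@pickle_invK index)); exact: iota_uniq.
apply: (measurable_fun_cvg
  (h := fun K y => \sum_(k <- r K) c k * \1_(lattice_cell W k) y)) => [K|y _].
  apply: measurable_sum => k; apply: measurable_funM => //.
  by apply: measurable_indic; exact: measurable_lattice_cell.
apply: cvg_near_cst; near=> K; apply/esym/cell_sumE => // b.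
rewrite mem_pmap; apply/mapP; exists (pickle (near_cell y b)).
  rewrite mem_iota/= add0n.
  apply: leq_trans (_ : (\max_b pickle (near_cell y b)).+1 <= K)%N.
    by rewrite ltnS; exact: (leq_bigmax (F := fun b => pickle (near_cell y b))).
  by near: K; exact: nbhs_infty_ge.
by rewrite pickleK_inv.
Unshelve. all: by end_near. Qed.

Lemma cell_sum_ge c y k : (forall j, 0 <= c j) -> lattice_cell W k y ->
  c k <= \sum_(j \in [set: index]) c j * \1_(lattice_cell W j) y.
Proof.
move=> c0 ky; have [b kb] := lattice_cell_near ky.
rewrite cell_sum_near (bigD1 b)//= -kb indicE mem_set// mulr1 lerDl.
by apply: sumr_ge0 => j _; rewrite mulr_ge0.
Qed.

Lemma cell_sum_le c y (m : R) :
  0 <= m -> (forall k, lattice_cell W k y -> c k <= m) ->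
  \sum_(j \in [set: index]) c j * \1_(lattice_cell W j) y <= (2 ^ d)%:R * m.
Proof.
move=> m0 cm; rewrite cell_sum_near.
apply: (@le_trans _ _ (\sum_(b : {ffun 'I_d -> bool}) m)).
  apply: ler_sum => b _; rewrite indicE.
  case: (boolP (y \in _)) => [|_]; last by rewrite mulr0.
  by rewrite inE mulr1; exact: cm.
by rewrite sumr_const card_ffun card_bool card_ord mulr_natl.
Qed.

Lemma cell_sum_ge0 c y : (forall j, 0 <= c j) ->
  0 <= \sum_(j \in [set: index]) c j * \1_(lattice_cell W j) y.
Proof.
by move=> c0; rewrite cell_sum_near; apply: sumr_ge0 => j _; rewrite mulr_ge0.
Qed.

End lattice_cells.

(** * Sampling *)

Section sampling_bounds.
Context {R : realType} (d : nat).
Local Notation Rd := 'rV[R]_d.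

Lemma big_nonzero_mi (F : multi_index d -> R) K :
  \sum_(0 <= n < K) oapp F 0 (nonzero_mi d n) = \sum_(a <- nonzero_mi_upto d K) F a.
Proof.
rewrite /nonzero_mi_upto /index_iota subn0; elim: (iota 0 K) => [|n r IH] /=.
  by rewrite !big_nil.
by rewrite big_cons IH; case: (nonzero_mi d n) => [a|]/=; rewrite ?add0r ?big_cons.
Qed.

Lemma sum_nonzero_mi_le_esum (w : multi_index d -> R) K : (forall a, 0 <= w a) ->
  (\esum_(a in [set a | a != mi0 d]) (w a)%:E < +oo)%E ->
  \sum_(a <- nonzero_mi_upto d K) w a <=
  fine (\esum_(a in [set a | a != mi0 d]) (w a)%:E).
Proof.
move=> w0 wfin; rewrite -lee_fin fineK; last first.
  by rewrite ge0_fin_numE// esum_ge0// => a _; rewrite lee_fin.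
apply: esum_ge; exists [set` nonzero_mi_upto d K].
  split; first exact: finite_seq.
  by move=> a /= /nonzero_mi_upto_neq0.
by rewrite -fsbig_seq ?nonzero_mi_upto_uniq// sumEFin.
Qed.

Variables (mu : {measure set Rd -> \bar R}) (q : R).
Variables (X : set (Rd -> R[i])) (N : (Rd -> R[i]) -> R).
Hypotheses (hq : 0 < q) (hX : quasi_banach_lattice mu q X N).

(** The majorant is that of the series of [W ^ - |a| / a! * |D^a g|]. Since [s / W <= A], the [q]-th
    power of the norm of each term is at most that of [A ^ |a| * B_a / a!] times [N g ^ q]. *)
Lemma band_limited_oscillation (B : multi_index d -> R) (A s W : R) g :
  (forall a, 0 < B a) -> 0 < A -> 0 < s -> s / A <= W ->
  (\esum_(a in [set a | a != mi0 d])
    ((A ^+ mi_abs a * B a / (mi_fact a)%:R) `^ q)%:E < +oo)%E ->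
  band_limited X s g ->
  (forall a, X (partials a g) /\ N (partials a g) <= B a * s ^+ mi_abs a * N g) ->
  exists f : Rd -> R, [/\ forall x, 0 <= f x, X (fun x => (f x)%:C),
    N (fun x => (f x)%:C) `^ q <= fine (\esum_(a in [set a | a != mi0 d])
      ((A ^+ mi_abs a * B a / (mi_fact a)%:R) `^ q)%:E) * N g `^ q &
    {ae mu, forall x : Rd, forall y : Rd,
      (forall i, `|y 0 i - x 0 i| <= W^-1) -> normc (g y - g x) <= f x}].
Proof.
move=> B0 A0 s0 sAW wfin bg hB.
have W0 : 0 < W by rewrite (lt_le_trans _ sAW)// divr_gt0.
have Xg : X g by have [] := bg.
pose w a := (A ^+ mi_abs a * B a / (mi_fact a)%:R) `^ q.
pose F a x := taylor_weight W^-1 a * normc (partials a g x).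
(* Numbers that code no nonzero multi-index contribute the zero function. *)
pose rho (n : nat) (x : Rd) : R := oapp (F ^~ x) 0 (nonzero_mi d n).
have rsA : s / W <= A by rewrite ler_pdivrMr// mulrC -ler_pdivrMr.
have wt0 (a : multi_index d) : 0 <= taylor_weight W^-1 a.
  by rewrite taylor_weight_ge0 ?invr_ge0 ?ltW.
have XF a : X (fun x => (F a x)%:C).
  have := qbl_scale hX (taylor_weight W^-1 a)%:C (qbl_abs hX (hB a).1).
  by congr X; apply/funext => x; rewrite /F -rmorphM.
have NF a : N (fun x => (F a x)%:C) `^ q <= w a * N g `^ q.
  have -> : N (fun x => (F a x)%:C) = taylor_weight W^-1 a * N (partials a g).
    rewrite -(lattice_normc hX (hB a).1) -[taylor_weight _ _]ger0_norm// -normc_real.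
    rewrite -(qbl_normZ hX).
      by congr N; apply/funext => x; rewrite /F -rmorphM.
    exact: (qbl_abs hX (hB a).1).
  have Ng0 := qbl_ge0 hX Xg.
  have P0 : 0 <= A ^+ mi_abs a * B a / (mi_fact a)%:R.
    by rewrite divr_ge0// mulr_ge0 ?exprn_ge0 ?(ltW A0) ?(ltW (B0 a)).
  rewrite /w -powRM//.
  apply: ge0_ler_powR; rewrite ?nnegrE ?(ltW hq)//.
  - by rewrite mulr_ge0// (qbl_ge0 hX)//; case: (hB a).
  - exact: mulr_ge0.
  - rewrite (le_trans (ler_wpM2l (wt0 a) (hB a).2))// mulrA ler_wpM2r//.
    rewrite /taylor_weight mulrAC ler_pM2r ?invr_gt0 ?ltr0n; last first.
      by apply: prodn_gt0 => i; exact: fact_gt0.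
    rewrite mulrCA mulrC ler_pM2r// -exprMn lerXn2r ?nnegrE ?mulr_ge0 ?invr_ge0
      ?(ltW W0) ?(ltW s0) ?(ltW A0)//.
    by rewrite mulrC.
have [n x|n|K|f [f0 Xf Nf hf]] :=
    @lattice_series_majorant _ _ _ _ _ _ hq hX rho
      (fine (\esum_(a in [set a | a != mi0 d]) (w a)%:E) * N g `^ q).
- by rewrite /rho; case: nonzero_mi => [a|]//=; rewrite mulr_ge0// normc_ge0.
- rewrite /rho; case: nonzero_mi => [a|]/=; first exact: XF.
  exact: (lattice_zero hX Xg).
- apply: (@le_trans _ _
    (\sum_(0 <= n < K) oapp (fun a => w a * N g `^ q) 0 (nonzero_mi d n))).
    apply: ler_sum => n _; rewrite /rho; case: nonzero_mi => [a|]/=; first exact: NF.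
    by rewrite (lattice_norm_zero hX Xg) powR0// gt_eqF.
  rewrite big_nonzero_mi -mulr_suml ler_wpM2r ?powR_ge0// sum_nonzero_mi_le_esum//.
  by move=> a; exact: powR_ge0.
exists f; split => //; apply: filterS hf => x hf y xy.
apply: (taylor_increment_le (r := W^-1)) bg xy _; first by rewrite invr_ge0 ltW.
by move=> K; rewrite -(big_nonzero_mi (F ^~ x)); exact: hf.
Qed.

End sampling_bounds.

Theorem theorem6p3 (R : realType) (d : nat) (hd : (0 < d)%N)
    (mu : {sigma_finite_measure set 'rV[R]_d -> \bar R})
    (q : R) (hq : 0 < q <= 1)
    (X : set ('rV[R]_d -> R[i])) (N : ('rV[R]_d -> R[i]) -> R)
    (hX : quasi_banach_lattice mu q X N)
    (B : multi_index d -> R) (hB : forall a, 0 < B a)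
    (A : R) (hA : 0 < A)
    (hsum : (\esum_(a in [set a : multi_index d | a != [ffun=> 0%N]])
      ((A ^+ mi_abs a * B a / (mi_fact a)%:R) `^ q)%:E < 1)%E) :
  exists c1 c2 : R, [/\ 0 < c1, 0 < c2 &
    forall sigma : R, 0 < sigma ->
      (forall (a : multi_index d) g, band_limited X sigma g ->
         X (partials a g) /\
         N (partials a g) <= B a * sigma ^+ mi_abs a * N g) ->
      forall g, band_limited X sigma g ->
      forall W : R, sigma / A <= W ->
      forall xi : {ffun 'I_d -> int} -> 'rV[R]_d,
        (forall k, lattice_cell W k (xi k)) ->
        (solid mu X -> X (sampled W xi g)) /\
        (X (sampled W xi g) ->
           c1 * N g <= N (sampled W xi g) <= c2 * N g)].
Proof.
have /andP[q0 q1] := hq.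
pose E := (\esum_(a in [set a : multi_index d | a != mi0 d])
      ((A ^+ mi_abs a * B a / (mi_fact a)%:R) `^ q)%:E)%E.
pose th := fine E.
have E0 : (0 <= E)%E by apply: esum_ge0 => a _; rewrite lee_fin powR_ge0.
have Elty : (E < +oo)%E by apply: lt_trans hsum _; exact: ltry.
have th0 : 0 <= th by exact: fine_ge0.
have th1 : th < 1 by rewrite -lte_fin fineK// ge0_fin_numE.
have th1' : 0 < 1 - th by rewrite subr_gt0.
have th2 : 0 < 1 + th by rewrite ltr_pwDl.
(* The [q]-th roots undo the powers in the [q]-triangle inequality; [2 ^ d] counts the closed cells
   that may meet at a point. *)
exists ((1 - th) `^ q^-1), ((2 ^ d)%:R * (1 + th) `^ q^-1).
have powK (t : R) : 0 < t -> (t `^ q^-1) `^ q = t.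
  by move=> t0; rewrite -powRrM mulVf ?gt_eqF// powRr1// ltW.
split; [exact: powR_gt0|by rewrite mulr_gt0 ?powR_gt0// ltr0n expn_gt0|].
move=> sigma s0 hB' g bg W sAW xi xiW.
have W0 : 0 < W by rewrite (lt_le_trans _ sAW)// divr_gt0.
have Xg : X g by have [] := bg.
have Ng0 := qbl_ge0 hX Xg.
have [f [f0 Xf Nf hf]] := band_limited_oscillation q0 hX hB hA s0 sAW Elty bg
  (fun a => hB' a g bg).
pose c k := normc (g (xi k)).
pose S y : R := \sum_(k \in [set: {ffun 'I_d -> int}]) c k * \1_(lattice_cell W k) y.
have c0 k : 0 <= c k by exact: normc_ge0.
have S0 y : 0 <= S y by exact: cell_sum_ge0.
have SE : sampled W xi g = fun y => (S y)%:C by [].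
pose H y : R[i] := (normc (g y))%:C + (f y)%:C.
have XH : X H := qbl_add hX (qbl_abs hX Xg) Xf.
have XH2 := qbl_scale hX (2 ^ d)%:R%:C XH.
have HE y : normc (H y) = normc (g y) + f y.
  by rewrite /H -rmorphD normc_real ger0_norm// addr_ge0// normc_ge0.
(* If [y] lies in cell [k], so does [xi k], hence their coordinates differ by at most [1 / W] and
   each active term is at most [|g y| + f y]. *)
have SH : {ae mu, forall y, normc (sampled W xi g y) <= normc ((2 ^ d)%:R%:C * H y)}.
  apply: filterS hf => y hfy.
  rewrite SE normc_real ger0_norm// normcM normc_real ger0_norm// HE.
  apply: cell_sum_le => //; first by rewrite addr_ge0// normc_ge0.
  move=> k ky; rewrite /c -[g (xi k)](subrK (g y)).
  rewrite (le_trans (le_normcD _ _))// [leRHS]addrC lerD2r.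
  apply: hfy => i; exact: lattice_cell_dist (xiW k) ky.
have mS : cmeasurable (sampled W xi g).
  by split; [exact: measurable_cell_sum|exact: measurable_cst].
split=> [hs|XS]; first exact: (hs _ _ mS XH2 SH).
have NS0 := qbl_ge0 hX XS.
apply/andP; split; last first.
  rewrite (le_trans (qbl_le hX XS XH2 SH))// (qbl_normZ hX)// normc_real ger0_norm//.
  rewrite -mulrA ler_wpM2l//; apply: (powR_le_inv q0).
  - exact: (qbl_ge0 hX).
  - by rewrite mulr_ge0// powR_ge0.
  rewrite powRM ?powR_ge0// powK//.
  rewrite (le_trans (qbl_triangle hX (qbl_abs hX Xg) Xf))//.
  by rewrite (lattice_normc hX Xg) mulrDl mul1r lerD2l.
apply: (powR_le_inv q0) => //; first by rewrite mulr_ge0// powR_ge0.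
(* The goal becomes [N g ^ q <= N S ^ q + th * N g ^ q], which follows from [|g| <= S + f]. *)
rewrite powRM ?powR_ge0// powK// mulrBl mul1r lerBlDr.
apply: (@le_trans _ _ (N (fun y => sampled W xi g y + (f y)%:C) `^ q)); last first.
  by rewrite (le_trans (qbl_triangle hX XS Xf))// lerD2l.
have XSf := qbl_add hX XS Xf.
apply: ge0_ler_powR; rewrite ?nnegrE ?(ltW q0) ?(qbl_ge0 hX)//.
apply: (qbl_le hX) => //; apply: filterS hf => y hfy.
rewrite SE -rmorphD normc_real ger0_norm ?addr_ge0//.
(* Any single cell containing [y] suffices here; this choice always contains it. *)
pose k := near_cell W y [ffun=> true].
have ky : lattice_cell W k y by exact: near_cell_true.
rewrite -[g y](subrK (g (xi k))) (le_trans (le_normcD _ _))// addrC lerD//.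
  exact: (cell_sum_ge W0 c0 ky).
rewrite -normcN opprB; apply: hfy => i; exact: lattice_cell_dist (xiW k) ky.
Qed.
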